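(* Let $E$ be a locally convex space and $r\in \mathbb{N}_0\cup\{\infty\}$. If $r=0$, let $M$ be a paracompact, locally compact, non-compact (Hausdorff) topological space; if $r>0$, let $M$ be a metrizable, non-compact, finite-dimensional $C^r$-manifold. Let $\theta(M)$ denote the compact covering number of $M$. Then \[ \Psi_{c,E}\colon C^r_c(M)\times E \to C^r_c(M,E),\quad (\gamma,v)\mapsto \gamma v,\qquad (\gamma v)(x):=\gamma(x)v, \] is a hypocontinuous bilinear map. The map $\Psi_{c,E}$ is continuous if and only if $E$ has the $\theta(M)$-neighbourhood property. If $E$ is metrizable, then $\Psi_{c,E}$ is continuous if and only if $E$ is normable.
   Context: A locally convex space is a Hausdorff locally convex real topological vector space; $\mathbb{N}_0=\{0,1,2,\ldots\}$. Continuity of a bilinear map means joint continuity. Neighbourhood property: for continuous seminorms $p,q$ on a locally convex space $E$, write $p\preceq q$ if there is $C>0$ with $p\leq Cq$ pointwise. For an infinite cardinal $\theta$, $E$ has the $\theta$-neighbourhood property if for each set $P$ of continuous seminorms on $E$ of cardinality $|P|\leq\theta$ there is a continuous seminorm $q$ on $E$ such that $p\preceq q$ for all $p\in P$. Compact covering number: for a Hausdorff topological space $M$, $\theta(M)$ is the smallest cardinality of a cover of $M$ by compact sets. Hypocontinuity: a bilinear map $\beta\colon E_1\times E_2\to F$ between locally convex spaces is hypocontinuous if it is separately continuous, the restriction $\beta|_{B\times E_2}$ is continuous for each bounded subset $B\subseteq E_1$, and $\beta|_{E_1\times B}$ is continuous for each bounded subset $B\subseteq E_2$. $C^r$-maps: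 if $U\subseteq\mathbb{R}^n$ is open, $\gamma\colon U\to E$ is $C^r$ if the partial derivatives $\partial^\alpha\gamma\colon U\to E$ exist and are continuous for all multi-indices $\alpha$ with $|\alpha|\leq r$; $C^r$-maps from manifolds to $E$ are defined via charts. For a $C^1$-map $\gamma\colon M\to E$ on a manifold, $d\gamma\colon TM\to E$ is the second component of the tangent map $T\gamma\colon TM\to TE\cong E\times E$. Topologies: if $r=0$, $C^0(M,E)=C(M,E)$ is the space of continuous functions with the compact-open topology. If $r>0$, set $d^0\gamma:=\gamma$, $T^0M:=M$, $T^kM:=T(T^{k-1}M)$, $d^k\gamma:=d(d^{k-1}\gamma)\colon T^kM\to E$ for $k\in\mathbb{N}$, $k\leq r$, and give the space $C^r(M,E)$ of $C^r$-maps the initial topology with respect to the maps $d^k\colon C^r(M,E)\to C(T^kM,E)$, $k\in\mathbb{N}_0$, $k\leq r$, where $C(T^kM,E)$ carries the compact-open topology. For compact $K\subseteq M$, $C^r_K(M,E):=\{\gamma\in C^r(M,E)\colon \mathrm{supp}(\gamma)\subseteq K\}$ carries the induced topology, and $C^r_c(M,E):=\bigcup_K C^r_K(M,E)$ (union over all compact $K\subseteq M$) carries the locally convex direct limit topology. $C^r_c(M):=C^r_c(M,\mathbb{R})$. *)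

(* Defs.v *)
From HB Require Import structures.
From mathcomp Require Import all_boot all_order all_algebra.
From mathcomp Require Import all_classical all_reals all_analysis.

Set Implicit Arguments.
Unset Strict Implicit.
Unset Printing Implicit Defensive.

Import Order.TTheory GRing.Theory Num.Theory.
Import numFieldTopology.Exports numFieldNormedType.Exports.

Local Open Scope classical_set_scope.
Local Open Scope card_scope.
Local Open Scope ring_scope.

Section LocallyConvex.
Context {R : realType}.

Definition seminorm (E : lmodType R) (p : E -> R) : Prop :=
  (forall x y, p (x + y) <= p x + p y) /\ (forall a x, p (a *: x) = `|a| * p x).

Definition cont_seminorm (E : tvsType R) : set (E -> R) :=
  [set p | seminorm p /\ continuous p].

Definition preceq (E : Type) (p q : E -> R) : Prop :=
  exists2 C : R, 0 < C & forall x, p x <= C * q x.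

(* The cardinal is represented by any set [theta] of that cardinality. *)
Definition neighbourhood_property (E : tvsType R) (T : Type) (theta : set T)
    : Prop :=
  forall P : set (E -> R), P `<=` @cont_seminorm E -> P #<= theta ->
    exists2 q, @cont_seminorm E q & forall p, P p -> preceq p q.

Definition normable (E : tvsType R) : Prop :=
  exists p : E -> R, [/\ seminorm p, (forall x, p x = 0 -> x = 0)
    & forall x (U : set E),
        nbhs x U <-> exists2 e : R, 0 < e & forall y, p (y - x) < e -> U y].

Definition von_neumann_bounded (E : preTopologicalLmodType R) (B : set E)
    : Prop :=
  forall U : set E, nbhs 0 U ->
    exists2 t : R, 0 < t & forall s, t <= `|s| -> B `<=` *:%R s @` U.

Definition hypocontinuous (E1 E2 F : preTopologicalLmodType R)
    (b : E1 -> E2 -> F) : Prop :=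
  [/\ (forall x, continuous (b x)) /\ (forall y, continuous (b ^~ y)),
      (forall B, von_neumann_bounded B ->
         {within B `*` [set: E2], continuous (fun p : E1 * E2 => b p.1 p.2)})
    & (forall B, von_neumann_bounded B ->
         {within [set: E1] `*` B, continuous (fun p : E1 * E2 => b p.1 p.2)})].

End LocallyConvex.

Definition metrizable (R : realType) (T : topologicalType) : Prop :=
  exists d : T -> T -> R,
    [/\ (forall x y, d x y = 0 <-> x = y), (forall x y, d x y = d y x),
        (forall x y z, d x z <= d x y + d y z)
      & forall x (U : set T),
          nbhs x U <-> exists2 e : R, 0 < e & forall y, d x y < e -> U y].

Definition open_cover (T : topologicalType) (U : set (set T)) : Prop :=
  U `<=` open /\ \bigcup_(A in U) A = setT.

Definition paracompact (T : topologicalType) : Prop :=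
  forall U : set (set T), open_cover U ->
    exists V : set (set T),
      [/\ open_cover V,
          (forall B, V B -> exists2 A, U A & B `<=` A)
        & forall x : T, exists2 N, nbhs x N &
            finite_set [set B | V B /\ B `&` N !=set0]].

Definition compact_cover (T : topologicalType) (C : set (set T)) : Prop :=
  C `<=` compact /\ \bigcup_(K in C) K = setT.

Definition min_compact_cover (T : topologicalType) (C : set (set T)) : Prop :=
  compact_cover C /\ forall C' : set (set T), compact_cover C' -> C #<= C'.

(* The compact covering number of [T], represented by a compact cover of least
   cardinality. *)
Definition compact_covering_number (T : topologicalType) : set (set T) :=
  xget set0 (@min_compact_cover T).
Arguments compact_covering_number : clear implicits.

(* Cardinals are well-ordered: a maximal set of sections of [F] that differ
   pairwise everywhere surjects onto some member of [F]. *)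
Lemma card_le_min (T : Type) (F : set (set T)) : F !=set0 ->
  exists2 A, F A & forall B, F B -> A #<= B.
Proof.
move=> [A0 FA0].
pose I := {B : set T | F B}.
pose P (G : set (I -> T)) := (forall g, G g -> forall i : I, sval i (g i)) /\
  (forall g h i, G g -> G h -> g i = h i -> g = h).
have [|G [[Gsec Ginj] Gmax]] := @Zorn_bigcup _ P.
- move=> C CP Ctot; split; first by move=> g [X /CP[+ _]]; exact.
  move=> g h i [X CX Xg] [Y CY Yh].
  have [_ Xi] := CP _ CX; have [_ Yi] := CP _ CY.
  by case: (Ctot _ _ CX CY) => XY; [apply: Yi => //; exact: XY
                                   |apply: Xi => //; exact: XY].
have [[i Gi]|nG] := pselect (exists i : I, sval i `<=` [set g i | g in G]).
  exists (sval i); first exact: svalP.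
  move=> B FB; pose j : I := exist _ B FB.
  apply: (card_le_trans (subset_card_le Gi)).
  apply: (card_le_trans (card_image_le _ _)).
  have eqG : [set g j | g in G] #= G.
    by apply: inj_card_eq => g h /set_mem Gg /set_mem Gh; exact: Ginj.
  rewrite -(card_le_eql eqG).
  by apply: subset_card_le => _ [g Gg <-]; exact: (Gsec g Gg j).
have /choice[g0 g0P] : forall i : I, exists x, sval i x /\
    ~ [set g i | g in G] x.
  move=> i; apply: contrapT => H; apply: nG; exists i => x ix.
  by apply: contrapT => nx; apply: H; exists x.
exfalso; apply: (Gmax (G `|` [set g0])).
  split; first by move=> g Gg; left.
  move=> /(_ g0 (or_intror erefl)) Gg0.
  by have [_] := g0P (exist _ A0 FA0); apply; exists g0.
split; first by move=> g [/Gsec//|-> i]; case: (g0P i).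
move=> g h i [Gg|->] [Gh|->]; [exact: Ginj| | |by []].
- by move=> e; case: (g0P i) => _ []; exists g.
- by move=> e; case: (g0P i) => _ []; exists h.
Qed.

Lemma compact_covering_numberP (T : topologicalType) :
  min_compact_cover (compact_covering_number T).
Proof.
rewrite /compact_covering_number; case: xgetP => // H; exfalso.
have [|C cC Cmin] := @card_le_min (set T) (@compact_cover T).
  exists [set [set x] | x in setT]; split.
    by move=> _ [x _ <-]; exact: compact_set1.
  by apply/seteqP; split => // x _; exists [set x] => //; exists x.
by apply: (H C); split.
Qed.

(* The order of differentiability: [Some m] is m, [None] is infinity. *)
Definition le_order (k : nat) (r : option nat) : bool :=
  if r is Some m then (k <= m)%N else true.

Section Calculus.
Context {R : realType} {n : nat}.

Definition diff_quot (F : tvsType R) (f : 'rV[R]_n -> F) (x v : 'rV[R]_n)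
    : R -> F :=
  fun h => h^-1 *: ((f \o shift x) (h *: v) - f x).

(* The library's ['D_v f x] requires a normed target; this is the limit of
   the difference quotients in a locally convex space [F], and 0 if there is
   none. *)
Definition dir_derive (F : tvsType R) (f : 'rV[R]_n -> F) (x v : 'rV[R]_n) : F :=
  xget 0 [set l | diff_quot f x v @ 0^' --> l].

Definition has_partial (F : tvsType R) (i : 'I_n) (f : 'rV[R]_n -> F)
    (x : 'rV[R]_n) (l : F) : Prop :=
  diff_quot f x (delta_mx 0 i) @ 0^' --> l.

(* [f] is C^r on the open set [V]: [D [:: i_1; ...; i_k]] is the iterated
   partial derivative of [f] in the directions i_k, ..., i_1, required to exist
   and be continuous on [V] in every order of differentiation, as the order is
   immaterial for the multi-index notation. Values of [f] and [D s] outside [V]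
   are irrelevant. *)
Definition Cr_on (F : tvsType R) (r : option nat) (V : set 'rV[R]_n)
    (f : 'rV[R]_n -> F) : Prop :=
  exists D : seq 'I_n -> 'rV[R]_n -> F,
    [/\ D [::] = f,
        (forall i s, le_order (size s).+1 r ->
           forall x, V x -> has_partial i (D s) x (D (i :: s) x))
      & (forall s, le_order (size s) r ->
           forall x, V x -> {for x, continuous (D s)})].

Lemma Cr_on0 (F : tvsType R) r V : Cr_on r V (0 : 'rV[R]_n -> F).
Proof.
exists (fun _ _ => 0); split => [//|i s _ x _|s _ x _].
  rewrite /has_partial (_ : diff_quot _ _ _ = cst 0); first exact: cvg_cst.
  by apply/funext => h; rewrite /diff_quot /= subrr scaler0.
exact: (@cst_continuous _ F 0 x).
Qed.

Lemma tvs_cvgZD (F : tvsType R) (T : Type) (G : set_system T) {FG : Filter G}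
    (a : R) (f g : T -> F) (l m : F) :
  f @ G --> l -> g @ G --> m -> (a *: f + g) @ G --> a *: l + m.
Proof.
move=> fl gm.
apply: (@continuous2_cvg _ F F F G FG (a *: f) g (fun x y => x + y)) => //.
  exact: (@add_continuous F (a *: l, m)).
apply: (@continuous2_cvg _ R^o F F G FG (fun=> a) f (fun x y => x *: y)) => //.
  exact: (@scale_continuous R F (a, l)).
exact: (@cvg_cst R^o a _ G).
Qed.

Lemma Cr_onZD (F : tvsType R) r V (a : R) (f g : 'rV[R]_n -> F) :
  Cr_on r V f -> Cr_on r V g -> Cr_on r V (a *: f + g).
Proof.
move=> [D [D0 DD Dc]] [D' [D'0 D'D D'c]].
exists (fun s => a *: D s + D' s); split; first by rewrite D0 D'0.
- move=> i s rs x Vx; rewrite /has_partial.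
  rewrite (_ : diff_quot _ _ _ =
    a *: diff_quot (D s) x (delta_mx 0 i) + diff_quot (D' s) x (delta_mx 0 i)).
    by apply: tvs_cvgZD; [exact: DD|exact: D'D].
  apply/funext => h; rewrite /diff_quot /= !fctE /= scalerA mulrC -scalerA.
  rewrite -scalerDr; congr (_ *: _).
  by rewrite opprD addrACA scalerBr.
- move=> s rs x Vx.
  exact: (@tvs_cvgZD _ _ _ (nbhs_filter x) a _ _ _ _ (Dc s rs x Vx) (D'c s rs x Vx)).
Qed.

Lemma tvs_cvgZl (F : tvsType R) (T : Type) (G : set_system T) {FG : Filter G}
    (f : T -> R^o) (l : R^o) (v : F) :
  f @ G --> l -> (fun x => f x *: v) @ G --> l *: v.
Proof.
move=> fl.
apply: (@continuous2_cvg _ R^o F F G FG f (fun=> v) (fun x y => x *: y)) => //.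
  exact: (@scale_continuous R F (l, v)).
exact: cvg_cst.
Qed.

Lemma Cr_onZl (F : tvsType R) r V (f : 'rV[R]_n -> R^o) (v : F) :
  Cr_on r V f -> Cr_on r V (fun x => f x *: v).
Proof.
move=> [D [D0 DD Dc]]; exists (fun s x => D s x *: v); split.
- by rewrite D0.
- move=> i s rs x Vx; rewrite /has_partial.
  rewrite (_ : diff_quot _ _ _ =
    fun h => diff_quot (D s) x (delta_mx 0 i) h *: v).
    by apply: tvs_cvgZl; exact: DD.
  by apply/funext => h; rewrite /diff_quot /= -scalerBl scalerA.
- move=> s rs x Vx.
  exact: (@tvs_cvgZl _ _ _ (nbhs_filter x) _ _ _ (Dc s rs x Vx)).
Qed.

End Calculus.

(* A topological space with the data of an atlas: [chart i] maps [dom i] to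
   [chart i @` dom i], with inverse [chart_inv i]; both are total functions
   whose values elsewhere are irrelevant. The chart [chart_at x] is a preferred
   chart around [x]. *)
Record charted (R : realType) := Charted {
  charted_space :> topologicalType;
  dim : nat;
  index : Type;
  dom : index -> set charted_space;
  chart : index -> charted_space -> 'rV[R]_dim;
  chart_inv : index -> 'rV[R]_dim -> charted_space;
  chart_at : charted_space -> index }.

Definition Cr_manifold (R : realType) (r : option nat) (M : charted R) : Prop :=
  [/\ forall x : M, dom (chart_at x) x,
      forall i : index M, open (dom i) /\ open (chart i @` dom i),
      forall (i : index M) x, dom i x -> chart_inv i (chart i x) = x,
      forall (i : index M) x, dom i x ->
        {for x, continuous (chart i)} /\
        {for chart i x, continuous (chart_inv i)}
    & forall i j : index M,
        Cr_on r (chart i @` (dom i `&` dom j)) (chart j \o chart_inv i)].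

Section TangentBundle.
Context {R : realType} (M : charted R).

(* The tangent vector at [foot] whose coordinates in the preferred chart at
   [foot] are [vec]. *)
Record tvec := Tvec { foot : M; vec : 'rV[R]_(dim M) }.

(* The coordinates in the chart [j] of the tangent vector at [x] with
   coordinates [v] in the chart [i]. *)
Definition change_chart (i j : index M) (x : M) (v : 'rV[R]_(dim M))
    : 'rV[R]_(dim M) :=
  'D_v (chart j \o chart_inv i) (chart i x).

Definition tdom (i : index M) : set tvec := [set w | dom i (foot w)].

Definition tchart (i : index M) (w : tvec) : 'rV[R]_(dim M + dim M) :=
  row_mx (chart i (foot w)) (change_chart (chart_at (foot w)) i (foot w) (vec w)).

Definition tchart_inv (i : index M) (y : 'rV[R]_(dim M + dim M)) : tvec :=
  let x := chart_inv i (lsubmx y) in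
  Tvec x (change_chart i (chart_at x) x (rsubmx y)).

HB.instance Definition _ := gen_eqMixin tvec.
HB.instance Definition _ := gen_choiceMixin tvec.

(* The topology making the bundle charts homeomorphisms onto open sets. *)
HB.instance Definition _ := isSubBaseTopological.Build tvec
  [set A | exists i (O : set 'rV[R]_(dim M + dim M)),
     open O /\ A = tdom i `&` tchart i @^-1` O] id.

Definition tangent : charted R :=
  @Charted R tvec (dim M + dim M) (index M) tdom tchart tchart_inv
    (fun w => chart_at (foot w)).

End TangentBundle.

(* The second component of the tangent map of [f]. *)
Definition tangent_map2 (R : realType) (E : tvsType R) (M : charted R)
    (f : M -> E) (w : tangent M) : E :=
  dir_derive (f \o chart_inv (chart_at (foot w)))
    (chart (chart_at (foot w)) (foot w)) (vec w).

(* The domains of the function spaces: topological spaces (used for r = 0) and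
   manifolds (used for r > 0). *)
Variant domain (R : realType) :=
| Space of topologicalType
| Manifold of charted R.

Definition points (R : realType) (M : domain R) : topologicalType :=
  match M with Space X => X | Manifold X => X end.

Coercion points : domain >-> topologicalType.

Definition admissible (R : realType) (r : option nat) (M : domain R) : Prop :=
  match M with
  | Space X => [/\ r = Some 0%N, hausdorff_space X, paracompact X,
                   locally_compact [set: X] & ~ compact [set: X]]
  | Manifold X => [/\ r <> Some 0%N, Cr_manifold r X, metrizable R X
                     & ~ compact [set: X]]
  end.

(* T^k M; on a mere space only [k = 0] matters. *)
Definition iter_tangent (R : realType) (k : nat) (M : domain R)
    : topologicalType :=
  match M with Space X => X | Manifold X => iter k tangent X end.

Fixpoint iter_d_manifold (R : realType) (E : tvsType R) (X : charted R)
    (f : X -> E) (k : nat) : iter k (@tangent R) X -> E :=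
  if k is k'.+1 return iter k (@tangent R) X -> E
  then tangent_map2 (iter_d_manifold f (k := k')) else f.

Definition iter_d (R : realType) (E : tvsType R) (M : domain R)
    : (M -> E) -> forall k, iter_tangent k M -> E :=
  match M with
  | Space X => fun f _ => f
  | Manifold X => fun f k => iter_d_manifold f (k := k)
  end.

Definition Cr_prop (R : realType) (E : tvsType R) (r : option nat) (M : domain R)
    : (M -> E) -> Prop :=
  match M with
  | Space X => fun f => continuous f
  | Manifold X => fun f => forall i : index X,
      Cr_on r (chart i @` dom i) (f \o chart_inv i)
  end.

Definition support (R : realType) (E : tvsType R) (X : topologicalType)
    (f : X -> E) : set X := closure [set x | f x != 0].

Lemma support0 (R : realType) (E : tvsType R) (X : topologicalType) :
  support (0 : X -> E) = set0.
Proof.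
rewrite /support (_ : [set x | _] = set0) ?closure0 //.
by apply/seteqP; split => // x /=; rewrite eqxx.
Qed.

Lemma supportZD (R : realType) (E : tvsType R) (X : topologicalType)
    (a : R) (f g : X -> E) :
  support (a *: f + g) `<=` support f `|` support g.
Proof.
rewrite /support -closureU; apply: closureS => x /= fg0.
have [f0|f0] := eqVneq (f x) 0; [right|by left].
by apply: contra_neq fg0 => g0; rewrite !fctE f0 g0 scaler0 addr0.
Qed.

Section FunctionSpaces.
Context {R : realType} (r : option nat) (M : domain R) (E : tvsType R).

Definition Cr_pred : {pred M -> E} := fun f => `[< Cr_prop r f >].

Lemma Cr_pred_closed : submod_closed Cr_pred.
Proof.
rewrite /Cr_pred; case: M => X; split => /=.
- by apply/asboolP => x; exact: cvg_cst.
- move=> a f g /asboolP fc /asboolP gc; apply/asboolP => x.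
  by apply: tvs_cvgZD; [exact: fc|exact: gc].
- by apply/asboolP => i; exact: Cr_on0.
- move=> a f g /asboolP fc /asboolP gc; apply/asboolP => i.
  exact: (Cr_onZD a (fc i) (gc i)).
Qed.

HB.instance Definition _ :=
  GRing.isSubmodClosed.Build R (M -> E) Cr_pred Cr_pred_closed.

Record Cr := MkCr { Cr_fun :> M -> E; Cr_funP : Cr_fun \in Cr_pred }.

HB.instance Definition _ := [isSub for Cr_fun].
HB.instance Definition _ := [Choice of Cr by <:].
HB.instance Definition _ := [SubChoice_isSubLmodule of Cr by <:].

Definition Cr_jet (f : Cr) :
    prod_topology (fun k : {k | le_order k r} =>
      {compact-open, iter_tangent (sval k) M -> E}) :=
  fun k => @iter_d R E M f (sval k).

HB.instance Definition _ := Topological.copy Cr (initial_topology Cr_jet).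

End FunctionSpaces.

Section DirectLimit.
Context {R : realType} (r : option nat) (M : domain R) (E : tvsType R).

Section FixedSupport.
Variable K : set M.

Definition CrK_pred : {pred Cr r M E} := fun f => `[< support f `<=` K >].

Lemma CrK_pred_closed : submod_closed CrK_pred.
Proof.
split; first by apply/asboolP; rewrite support0.
move=> a f g /asboolP fK /asboolP gK; apply/asboolP.
apply: (subset_trans (@supportZD _ _ _ a (Cr_fun f) (Cr_fun g))).
by rewrite subUset.
Qed.

HB.instance Definition _ :=
  GRing.isSubmodClosed.Build R (Cr r M E) CrK_pred CrK_pred_closed.

Record CrK := MkCrK { CrK_val :> Cr r M E; CrK_valP : CrK_val \in CrK_pred }.

HB.instance Definition _ := [isSub for CrK_val].
HB.instance Definition _ := [Choice of CrK by <:].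
HB.instance Definition _ := [SubChoice_isSubLmodule of CrK by <:].

HB.instance Definition _ := Topological.copy CrK (initial_topology CrK_val).

End FixedSupport.

Definition Crc_pred : {pred Cr r M E} :=
  fun f => `[< exists2 K : set M, compact K & support f `<=` K >].

Lemma Crc_pred_closed : submod_closed Crc_pred.
Proof.
split.
  by apply/asboolP; exists set0; [exact: compact0|rewrite support0].
move=> a f g /asboolP[K cK fK] /asboolP[L cL gL]; apply/asboolP.
exists (K `|` L); first exact: compactU.
apply: (subset_trans (@supportZD _ _ _ a (Cr_fun f) (Cr_fun g))).
exact: setUSS.
Qed.

HB.instance Definition _ :=
  GRing.isSubmodClosed.Build R (Cr r M E) Crc_pred Crc_pred_closed.

Record Crc := MkCrc { Crc_val :> Cr r M E; Crc_valP : Crc_val \in Crc_pred }.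

HB.instance Definition _ := [isSub for Crc_val].
HB.instance Definition _ := [Choice of Crc by <:].
HB.instance Definition _ := [SubChoice_isSubLmodule of Crc by <:].

Lemma CrK_Crc (K : set M) (cK : compact K) (f : CrK K) :
  CrK_val f \in Crc_pred.
Proof. by apply/asboolP; exists K => //; exact/asboolP/(CrK_valP f). Qed.

Definition CrK_incl (K : set M) (cK : compact K) (f : CrK K) : Crc :=
  MkCrc (CrK_Crc cK f).

(* The elements of a 0-neighbourhood base of the locally convex direct limit topology: the
   convex sets that meet each step in a 0-neighbourhood of it. *)
Definition lim_nbhs0 (W : set Crc) : Prop :=
  convex_set (W : set (convex_lmodType Crc)) /\
  forall (K : set M) (cK : compact K), nbhs (0 : CrK K) (CrK_incl cK @^-1` W).

Definition lim_open (A : set Crc) : Prop :=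
  forall f, A f -> exists2 W, lim_nbhs0 W & forall w, W w -> A (f + w).

Lemma lim_openT : lim_open setT.
Proof.
move=> f _; exists setT => //; split; last by move=> K cK; exact: filterT.
by move=> x y l _ _; exact/mem_set.
Qed.

Lemma lim_openI : setI_closed lim_open.
Proof.
move=> A B oA oB f [/oA[V [Vc V0] VA] /oB[W [Wc W0] WB]].
exists (V `&` W); last by move=> w [Vw Ww]; split; [exact: VA|exact: WB].
split; last by move=> K cK; apply: filterI; [exact: V0|exact: W0].
move=> x y l; rewrite !inE => -[Vx Wx] [Vy Wy].
by split; apply/set_mem; [apply: Vc|apply: Wc]; exact/mem_set.
Qed.

Lemma lim_open_bigU (I : Type) (A : I -> set Crc) :
  (forall i, lim_open (A i)) -> lim_open (\bigcup_i A i).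
Proof.
move=> oA f [i _ /oA[W W0 WA]]; exists W => // w Ww.
by exists i => //; exact: WA.
Qed.

HB.instance Definition _ :=
  isOpenTopological.Build Crc lim_openT lim_openI lim_open_bigU.

End DirectLimit.

Section Psi.
Context {R : realType} (r : option nat) (M : domain R) (E : tvsType R).

Lemma mul_Cr (f : Cr r M R^o) (v : E) :
  (fun x => f x *: v) \in @Cr_pred R r M E.
Proof.
move: f => [f]; rewrite /Cr_pred; case: M f => X f /asboolP /= fC; apply/asboolP.
  by move=> x; apply: tvs_cvgZl; exact: fC.
by move=> i; exact: (Cr_onZl v (fC i)).
Qed.

Lemma mul_Crc (f : Crc r M R^o) (v : E) : MkCr (mul_Cr f v) \in @Crc_pred R r M E.
Proof.
have /asboolP[K cK fK] := Crc_valP f; apply/asboolP; exists K => //.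
apply: subset_trans fK; apply: closureS => x /=.
by apply: contra_neq => ->; rewrite scale0r.
Qed.

Definition Psi (f : Crc r M R^o) (v : E) : Crc r M E := MkCrc (mul_Crc f v).

End Psi.

(* Main.v *)
Require Import Defs.
From HB Require Import structures.
From mathcomp Require Import all_boot all_order all_algebra.
From mathcomp Require Import all_classical all_reals all_analysis.
From mathcomp Require finmap.
From mathcomp Require Import ring lra.

Set Implicit Arguments.
Unset Strict Implicit.
Unset Printing Implicit Defensive.

Import Order.TTheory GRing.Theory Num.Theory.
Import numFieldTopology.Exports numFieldNormedType.Exports.

Local Open Scope classical_set_scope.
Local Open Scope ring_scope.

(** The map Psi is studied on one step C^r_K(M) x E -> C^r_K(M,E) at a time. There
   d^k(f v) = (d^k f) v, an identity valid for every f (dir_derive_mul), since the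
   difference quotients of f v live on the line through v, where they converge if and
   only if those of f do. Hence Psi is continuous at (0, 0) on each step (PsiK_small). The
   direct limit topology is accessible through convex 0-neighbourhoods whose traces on the
   steps are 0-neighbourhoods; since Psi is linear in f, a set of the form
   { f | f v in W for all v in B } is automatically convex (convex_Psi), and only its
   traces have to be examined.

   Hypocontinuity. If B is bounded in E, the set above is a 0-neighbourhood because B is
   absorbed by the neighbourhood of E found on each step (lim_nbhs0_Psi). If B is bounded
   in C^r_c(M), all members of B are supported in one compact set
   (bounded_common_support), the limit induces on that step its own topology
   (Crc_step_trace), and the estimate on the step applies (Psi_bounded_small).

   Neighbourhood property implies continuity. Fatten the members of a compact cover of M
   of least cardinality theta; every compact set lies in a finite union of them. Each
   finite union s has a seminorm p_s that serves on its step, and a single seminorm q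
   dominates all p_s (neighbourhood_seq). Then { f | f v in W whenever q v < 1 } is a
   0-neighbourhood (neighbourhood_Psi_continuous).

   Continuity implies the neighbourhood property. M has a locally finite cover by
   relatively compact sets, of cardinality at least theta (covering_number_le). Attaching
   to each seminorm p of the given family a point x_p in a member of its own, the
   conditions p (g (x_p)) < 1 define a 0-neighbourhood of C^r_c(M,E). Continuity of Psi,
   tested on bump functions at the points x_p, bounds each p by a multiple of one
   continuous seminorm (Psi_continuous_neighbourhood). As theta is infinite, a metrizable
   space with the neighbourhood property is normable (neighbourhood_normable).

   Two tools remain. For r > 0 the cover comes from a maximal separated set
   (relcompact_cover_metrizable). The real-valued calculus, needed to see that d^k f is
   continuous, hence bounded on compact sets, and to construct bump functions, rests on a
   recursive notion of class C^k, stable under composition, for which the tangent bundle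
   of a C^(s+1)-manifold is again a manifold, of class C^s, and df is of class C^s when f
   is of class C^(s+1) (tangent_atlas, Ck_fun_tangent). *)

(** * Seminorms and the neighbourhood property *)

Lemma ltr_convex (R : realType) (t a b c : R) :
  0 <= t <= 1 -> a < c -> b < c -> t * a + (1 - t) * b < c.
Proof.
move=> /andP[t0 t1] ac bc; have t1' : 0 <= 1 - t by rewrite subr_ge0.
have [->|tn0] := eqVneq t 0; first by rewrite mul0r add0r subr0 mul1r.
have tp : 0 < t by rewrite lt_neqAle eq_sym tn0.
have ta : t * a < t * c by rewrite ltr_pM2l.
have tb : (1 - t) * b <= (1 - t) * c by apply: ler_wpM2l => //; exact: ltW.
by apply: lt_le_trans (ltr_leD ta tb) _; rewrite -mulrDl addrC subrK mul1r.
Qed.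

Section Seminorms.
Context {R : realType} {E : lmodType R}.
Implicit Types p q : E -> R.

Lemma seminorm0 p : seminorm p -> p 0 = 0.
Proof. by case=> _ pZ; rewrite -(scale0r 0) pZ normr0 mul0r. Qed.

Lemma seminormN p x : seminorm p -> p (- x) = p x.
Proof. by case=> _ pZ; rewrite -scaleN1r pZ normrN1 mul1r. Qed.

Lemma seminorm_ge0 p x : seminorm p -> 0 <= p x.
Proof.
move=> sp; have := sp.1 x (- x); rewrite subrr seminorm0// seminormN//.
by rewrite -mulr2n pmulrn_lge0.
Qed.

Lemma seminorm_dist p x y : seminorm p -> `|p x - p y| <= p (x - y).
Proof.
move=> sp; rewrite ler_norml; apply/andP; split.
  rewrite lerNl opprB lerBlDr -(seminormN (x - y) sp) opprB.
  by rewrite -{1}(subrK x y); exact: sp.1.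
by rewrite lerBlDr -{1}(subrK y x); exact: sp.1.
Qed.

(** By homogeneity, comparing two seminorms amounts to comparing their unit balls. *)
Lemma preceq_ball p q C : seminorm p -> seminorm q -> 0 < C ->
  (forall x, q x < 1 -> p x < C) -> preceq p q.
Proof.
move=> sp sq C0 H; exists C => // x; rewrite leNgt; apply/negP => lt.
pose s := p x / C.
have qs : q x < s by rewrite ltr_pdivlMr// mulrC.
have s0 : 0 < s by apply: le_lt_trans qs; exact: seminorm_ge0.
have px0 : 0 < p x.
  by apply: le_lt_trans lt; apply: mulr_ge0; [exact: ltW|exact: seminorm_ge0].
have := H (s^-1 *: x); rewrite sq.2 sp.2 normfV gtr0_norm//.
rewrite ltr_pdivrMl// mulr1 => /(_ qs).
by rewrite /s invf_div divfK ?ltxx// gt_eqF.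
Qed.

Lemma convex_setP (W : set E) :
  convex_set (W : set (convex_lmodType E)) <->
  forall t x y, 0 <= t <= 1 -> W x -> W y -> W (t *: x + (1 - t) *: y).
Proof.
split=> [cW t x y /andP[t0 t1] Wx Wy|cW x y l /set_mem Wx /set_mem Wy].
  pose l : {i01 R} := Itv01 t0 t1.
  by apply/set_mem; exact: (cW x y l (mem_set Wx) (mem_set Wy)).
by apply/mem_set; apply: cW => //; apply/andP; split.
Qed.

Lemma convex_seminorm_ball p e : seminorm p ->
  convex_set ([set x | p x < e] : set (convex_lmodType E)).
Proof.
move=> [pD pZ]; apply/convex_setP => t x y t01 /= px py.
have /andP[t0 t1] := t01; apply: le_lt_trans (pD _ _) _.
by rewrite !pZ (ger0_norm t0) ger0_norm ?subr_ge0//; exact: ltr_convex.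
Qed.

End Seminorms.

Section Gauge.
Context {R : realType} {E : tvsType R}.
Implicit Types (p q : E -> R) (U V : set E).

Lemma seminorm_continuous p : seminorm p -> nbhs 0 [set x | p x < 1] ->
  continuous p.
Proof.
move=> sp p1 x; apply/(@cvgrPdist_lt _ R^o) => e e0.
have e0' : e != 0 by rewrite gt_eqF.
have := nbhsT x (nbhs0Z e0' p1).
apply: filterS => _ [_ [z /= pz <-] <-].
rewrite (le_lt_trans (seminorm_dist _ _ sp))//.
rewrite opprD addrA subrr add0r (seminormN _ sp) sp.2 gtr0_norm//.
by rewrite -ltr_pdivlMl// mulVf.
Qed.

Lemma cont_seminorm_ball p e : cont_seminorm p -> 0 < e ->
  nbhs (0 : E) [set x | p x < e].
Proof.
move=> [sp cp] e0; have /(@cvgrPdist_lt _ R^o)/(_ _ e0) := cp 0.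
apply: filterS => x /=; rewrite seminorm0// sub0r normrN.
exact: le_lt_trans (ler_norm _).
Qed.

Lemma tvs_absorbing (x : E) U : nbhs 0 U ->
  \forall t \near (0 : R), U (t *: x).
Proof.
move=> U0.
have /(_ U) : (fun t : R^o => t *: x) @ (0 : R^o) --> (0 : R^o) *: x.
  by apply: tvs_cvgZl; exact: cvg_id.
by rewrite scale0r => /(_ U0).
Qed.

(** Minkowski functional of a symmetric convex neighbourhood inside U: this is how
   seminorms enter a space whose local convexity is given by neighbourhoods. *)
Lemma gauge U : nbhs 0 U ->
  exists2 p, cont_seminorm p & [set x | p x < 1] `<=` U.
Proof.
move=> U0.
have [B Bc [Bo Bb]] := @locally_convex R E.
have [b [Bbb b0] bU] := Bb 0 U U0.
have bn : nbhs 0 b by apply: open_nbhs_nbhs; split => //; exact: Bo.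
have /convex_setP cb := Bc _ (mem_set Bbb).
pose V := b `&` -%R @` b.
have nV : nbhs 0 V by apply: filterI => //; exact: nbhs0N.
have VN x : V x -> V (- x).
  by move=> [bx [y bY yx]]; split; [rewrite -yx opprK|exists x].
have V0 : V 0 by exact: nbhs_singleton.
have cV t x y : 0 <= t <= 1 -> V x -> V y -> V (t *: x + (1 - t) *: y).
  move=> t01 [bx [x' bx' xE]] [by_ [y' by' yE]]; split; first exact: cb.
  exists (t *: x' + (1 - t) *: y'); first exact: cb.
  by rewrite -xE -yE !scalerN -opprD.
have ratio01 (s t : R) : 0 < s -> s <= t -> 0 <= s / t <= 1.
  move=> s0 st; have t0 : 0 < t by exact: lt_le_trans st.
  by rewrite divr_ge0 ?(ltW s0) ?(ltW t0)//= ler_pdivrMr// mul1r.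
pose S x := [set t : R | 0 < t /\ V (t^-1 *: x)].
have Sub t t' x : S x t -> t <= t' -> S x t'.
  move=> [t0 Vt] tt'; split; first exact: lt_le_trans tt'.
  have t'0 : 0 < t' by exact: lt_le_trans tt'.
  have -> : t'^-1 *: x = (t / t') *: (t^-1 *: x) + (1 - t / t') *: 0.
    rewrite scaler0 addr0 scalerA; congr (_ *: _).
    by rewrite mulrAC divff ?mul1r// gt_eqF.
  by apply: cV => //; exact: ratio01.
have Sn x : S x !=set0.
(* V absorbs x, so the infimum below is taken over a nonempty set. *)
  have /nbhs_ballP[e /= e0 eV] := tvs_absorbing x nV.
  exists (e / 2)^-1; split; first by rewrite invr_gt0; exact: divr_gt0.
  rewrite invrK; apply: eV; rewrite -ball_normE /= sub0r normrN.
  by rewrite gtr0_norm; [lra|exact: divr_gt0].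
have Slb x : lbound (S x) 0 by move=> t [/ltW].
have SD x y s t : S x s -> S y t -> S (x + y) (s + t).
  move=> [s0 Vs] [t0 Vt]; have st0 : 0 < s + t by exact: addr_gt0.
  split => //.
  have -> : (s + t)^-1 *: (x + y) =
      (s / (s + t)) *: (s^-1 *: x) + (1 - s / (s + t)) *: (t^-1 *: y).
    rewrite !scalerA scalerDr; congr (_ *: _ + _ *: _).
      by rewrite mulrAC divff ?mul1r// gt_eqF.
    by field; rewrite !gt_eqF.
  by apply: cV => //; apply: ratio01 => //; rewrite lerDl ltW.
have SZ a x t : a != 0 -> S x t -> S (a *: x) (`|a| * t).
  move=> a0 [t0 Vt]; have na0 : 0 < `|a| by rewrite normr_gt0.
  split; first exact: mulr_gt0.
  have -> : (`|a| * t)^-1 *: (a *: x) = (a / `|a|) *: (t^-1 *: x).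
    rewrite !scalerA; congr (_ *: _); rewrite invfM; ring.
  have [ap|an|a00] := ltrgtP 0 a.
  - by rewrite gtr0_norm// divff// scale1r.
  - by rewrite ltr0_norm// invrN mulrN divff// scaleN1r; exact: VN.
  - by rewrite -a00 eqxx in a0.
pose p x := inf (S x).
have pS x e : p x < e -> S x e.
  by move=> /(inf_lt (Sn x))[t St te]; exact: Sub St (ltW te).
have Sp x t : S x t -> p x <= t.
  by move=> St; apply: ge_inf => //; exists 0; exact: Slb.
have pD x y : p (x + y) <= p x + p y.
  apply/ler_addgt0Pr => e e0.
  have e2 : 0 < e / 2 by exact: divr_gt0.
  by rewrite [e]splitr addrACA; apply/Sp/SD; apply: pS; rewrite ltrDl.
have pZle a x : a != 0 -> p (a *: x) <= `|a| * p x.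
  move=> a0; have na0 : 0 < `|a| by rewrite normr_gt0.
  apply/ler_addgt0Pr => e e0.
  have -> : `|a| * p x + e = `|a| * (p x + e / `|a|).
    by rewrite mulrDr mulrCA divff ?mulr1// gt_eqF.
  by apply/Sp/SZ => //; apply: pS; rewrite ltrDl divr_gt0.
have p00 : p 0 = 0.
  apply/eqP; rewrite eq_le; apply/andP; split; last first.
    by apply: lb_le_inf; [exact: Sn|exact: Slb].
  apply/ler_addgt0Pr => e e0; rewrite add0r; apply: Sp; split => //.
  by rewrite scaler0.
have sp : seminorm p.
  split => // a x; have [->|a0] := eqVneq a 0.
    by rewrite scale0r p00 normr0 mul0r.
  apply/eqP; rewrite eq_le pZle//=.
  have na0 : 0 < `|a| by rewrite normr_gt0.
  rewrite -ler_pdivlMl// -normfV.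
  rewrite -{1}[x]scale1r -(mulVf a0) -scalerA.
  by apply: pZle; rewrite invr_eq0.
exists p.
  split => //; apply: seminorm_continuous => //.
  have h0 : 2^-1 != 0 :> R by rewrite invr_eq0.
  have := nbhs0Z h0 nV; apply: filterS => _ [x Vx <-] /=.
  apply: (@le_lt_trans _ _ 2^-1); last by rewrite invf_lt1// ltr1n.
  by apply: Sp; split; [rewrite invr_gt0|rewrite scalerA mulVf// scale1r].
by move=> x /= /pS[_]; rewrite invr1 scale1r => -[/bU].
Qed.

Lemma preceq_trans p q r : preceq p q -> preceq q r -> preceq p r.
Proof.
move=> [C C0 pq] [D D0 qr]; exists (C * D); first exact: mulr_gt0.
by move=> x; rewrite -mulrA (le_trans (pq x))// ler_pM2l.
Qed.

Lemma nbhs_translate (x : E) U :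
  nbhs x U <-> nbhs (0 : E) [set y | U (x + y)].
Proof.
split=> [/(@nbhsB _ _ U x (- x))|/(@nbhsT _ _ _ x)].
  by rewrite addNr; apply: filterS => _ [y Uy <-]/=; rewrite addNKr.
by apply: filterS => _ [y /= Uy <-].
Qed.

Section NeighbourhoodProperty.
Context {T : Type} (theta : set T) (thE : neighbourhood_property E theta).

Lemma neighbourhood_family (p : T -> E -> R) :
  (forall t, theta t -> cont_seminorm (p t)) ->
  exists2 q, cont_seminorm q & forall t, theta t -> preceq (p t) q.
Proof.
move=> cp; have [_ [t tt <-]||q cq pq] := thE (P := p @` theta).
- exact: cp.
- exact: card_image_le.
- by exists q => // t tt; apply: pq; exists t.
Qed.

Context (thinf : infinite_set theta).

Lemma neighbourhood_sequence (p : nat -> E -> R) :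
  (forall n, cont_seminorm (p n)) ->
  exists2 q, cont_seminorm q & forall n, preceq (p n) q.
Proof.
move=> cp; have [_ [n _ <-]||q cq pq] := thE (P := range p).
- exact: cp.
- by apply: card_le_trans (card_image_le _ _) _; exact/infiniteP.
- by exists q => // n; apply: pq; exists n.
Qed.

End NeighbourhoodProperty.

(** Families indexed by the finite sequences over theta are handled without cardinal
   arithmetic: one seminorm dominates all sequences of a given length, by induction
   on the length, and countably many lengths remain. *)
Lemma neighbourhood_seq (T : eqType) (theta : set T) (p : seq T -> E -> R) :
  neighbourhood_property E theta -> infinite_set theta ->
  (forall s, cont_seminorm (p s)) ->
  exists2 q, cont_seminorm q &
    forall s, (forall t, t \in s -> theta t) -> preceq (p s) q.
Proof.
move=> thE thinf cp.
have /choice[q qP] : forall n, exists q, cont_seminorm q /\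
    forall s, size s = n -> (forall t, t \in s -> theta t) -> preceq (p s) q.
  move=> n; elim: n p cp => [|n IH] p cp.
    exists (p [::]); split => // s /size0nil -> _.
    by exists 1 => // x; rewrite mul1r.
  have /choice[q qP] t : exists q, cont_seminorm q /\
      forall s, size s = n -> (forall t, t \in s -> theta t) ->
        preceq (p (t :: s)) q by exact: IH.
  have [|r cr rP] := neighbourhood_family thE (p := q).
    by move=> t _; case: (qP t).
  exists r; split => // -[//|t s] [sn] ths.
  apply: preceq_trans (rP t _); last by apply: ths; exact: mem_head.
  by apply: (qP t).2 => // u us; apply: ths; rewrite inE us orbT.
have [|r cr rP] := neighbourhood_sequence thE thinf (p := q).
  by move=> n; case: (qP n).
exists r => // s ths; apply: preceq_trans (rP (size s)).
exact: (qP (size s)).2.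
Qed.

Lemma normable_neighbourhood (T : Type) (theta : set T) :
  normable E -> neighbourhood_property E theta.
Proof.
move=> [q [sq _ qn]] P Pc _.
have cq : cont_seminorm q.
  split => //; apply: seminorm_continuous => //.
  by apply/(qn 0); exists 1 => // y; rewrite subr0.
exists q => // p /Pc pc.
have /(qn 0)[e e0 qe] := cont_seminorm_ball pc ltr01.
apply: (@preceq_ball _ _ _ _ e^-1) => //; [by case: pc|by rewrite invr_gt0|].
move=> x qx; have /= := qe (e *: x).
rewrite subr0 sq.2 pc.1.2 gtr0_norm// gtr_pMr// => /(_ qx).
by rewrite -ltr_pdivlMl// mulr1.
Qed.

(** A countable base of 0-neighbourhoods gives countably many seminorms; one that
   dominates them all defines the topology. *)
Lemma neighbourhood_normable (T : Type) (theta : set T) :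
  metrizable R E -> infinite_set theta -> neighbourhood_property E theta ->
  normable E.
Proof.
move=> [d [d0 dC dT dn]] thinf thE.
have /choice[p pP] n : exists p : E -> R, cont_seminorm p /\
    [set x | p x < 1] `<=` [set y | d 0 y < n.+1%:R^-1].
  have [|p cp pd] := @gauge [set y | d 0 y < n.+1%:R^-1].
    by apply/dn; exists n.+1%:R^-1.
  by exists p.
have [|q cq qP] := neighbourhood_sequence thE thinf (p := p).
  by move=> n; case: (pP n).
have small e : 0 < e -> exists2 C, 0 < C & forall x, q x < C -> d 0 x < e.
  move=> e0; have /ltr_add_invr[n] := e0; rewrite add0r => ne.
  have [C C0 pC] := qP n.
  exists C^-1; first by rewrite invr_gt0.
  move=> x qx; apply: lt_trans ne; apply: (pP n).2 => /=.
  apply: le_lt_trans (pC x) _.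
  by rewrite -ltr_pdivlMl// mulr1.
exists q; split; first by case: cq.
  move=> x qx; apply/esym/d0/eqP; rewrite eq_le; apply/andP; split.
    apply/ler_addgt0Pr => e /small[C C0 qC]; rewrite add0r ltW//.
    by apply: qC; rewrite qx.
  have := dT 0 x 0; rewrite (dC x) (d0 0 0).2// => h.
  by rewrite -(@pmulrn_lge0 _ _ 2)// mulr2n.
move=> x U; split.
  move=> /nbhs_translate/dn[e e0 eU].
  have [C C0 qC] := small _ e0.
  by exists C => // y /qC/eU /=; rewrite addrC subrK.
move=> [e e0 qU]; apply/nbhs_translate.
apply: filterS (cont_seminorm_ball cq e0) => y /= qy.
by apply: qU; rewrite addrAC subrr add0r.
Qed.

End Gauge.

(** * Locally finite covers by relatively compact sets *)

Section LocallyFinite.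
Context {T : topologicalType}.
Implicit Types (K S : set T) (V C : set (set T)).

Definition locally_finite (I : Type) (D : set I) (V : I -> set T) : Prop :=
  forall x : T, exists2 N, nbhs x N &
    finite_set [set i | D i /\ V i `&` N !=set0].

(** Apply the near-covering form of compactness to the cofinite filter on the index
   set: near each point only finitely many members are met. *)
Lemma locally_finite_compact (I : Type) (D : set I) (V : I -> set T) K :
  locally_finite D V -> compact K ->
  finite_set [set i | D i /\ V i `&` K !=set0].
Proof.
move=> lfV /compact_near_coveringP cK.
pose F : set_system I := [set P | finite_set (D `\` P)].
have FF : Filter F.
  split; first by rewrite /F /= setDT.
    by move=> P Q fP fQ; rewrite /F /= setDIr; rewrite finite_setU.
  by move=> P Q PQ; apply: sub_finite_set => i [Di nQ]; split => // /PQ.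
have [x Kx|] := cK I F (fun i x => ~ (D i /\ V i x)) FF.
  have [N Nx fN] := lfV x.
  exists (N, ~` [set i | D i /\ V i `&` N !=set0]).
    split => //=; apply: sub_finite_set fN => i [Di]; exact: contrapT.
  by move=> [y i] /= [Ny Hi] [Di Viy]; apply: Hi; split => //; exists y.
move=> n fK; have {}fK : finite_set
    (D `\` [set i | K `<=` (fun x => ~ (D i /\ V i x))]) by exists n.
apply: sub_finite_set fK => i [Di [x [Vix Kx]]]; split => //.
by move=> /(_ x Kx); apply.
Qed.

(** What paracompactness and local compactness are used for. Nonemptiness of the
   members allows choosing a point in each of them. *)
Definition relcompact_cover V : Prop :=
  [/\ \bigcup_(A in V) A = setT, (forall A, V A -> A !=set0),
      (forall A, V A -> exists2 K, compact K & A `<=` K)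
    & locally_finite V id].

Lemma finite_bigcup_compact (I : choiceType) (D : set I) (F : I -> set T) :
  finite_set D -> (forall i, D i -> compact (F i)) ->
  compact (\bigcup_(i in D) F i).
Proof.
move=> /finite_seqP[s ->] cF; rewrite bigcup_seq big_seq.
by apply: bigsetU_compact => i; exact: cF.
Qed.

Lemma covering_number_infinite :
  ~ compact [set: T] -> infinite_set (compact_covering_number T).
Proof.
move=> ncT fT; have [[cC uC] _] := compact_covering_numberP T.
apply: ncT; rewrite -uC; exact: finite_bigcup_compact.
Qed.

(** Each member lies in a compact set, so the cover has at least as many members as
   a compact cover of least size. *)
Lemma covering_number_le V :
  relcompact_cover V -> (compact_covering_number T #<= V)%card.
Proof.
move=> [uV _ kV _]; have [_ Cmin] := compact_covering_numberP T.
have /choice[k kP] A : exists K, V A -> compact K /\ A `<=` K.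
  have [VA|nVA] := pselect (V A); last by exists set0.
  by have [K cK AK] := kV A VA; exists K.
apply: card_le_trans (card_image_le k V); apply: Cmin; split.
  by move=> _ [A VA <-]; exact: (kP A VA).1.
rewrite -subTset -uV => x [A VA Ax]; exists (k A); first by exists A.
exact: (kP A VA).2.
Qed.

(** Infinitely many members of the cover meet S; points chosen in distinct ones
   leave every compact set. *)
Lemma not_relcompact_sequence V S :
  relcompact_cover V -> (forall K, compact K -> ~ S `<=` K) ->
  exists x : nat -> T, (forall n, S (x n)) /\
    forall K, compact K -> finite_set [set n | K (x n)].
Proof.
move=> [uV _ kV lfV] nS.
pose VS := [set A | V A /\ A `&` S !=set0].
have iVS : infinite_set VS.
  move=> fVS.
  have /choice[k kP] A : exists K, VS A -> compact K /\ A `<=` K.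
    have [[VA _]|nVA] := pselect (VS A); last by exists set0.
    by have [K cK AK] := kV A VA; exists K.
  apply: (nS (\bigcup_(A in VS) k A)).
    by apply: finite_bigcup_compact => // A /kP[].
  move=> x Sx; have : setT x by [].
  rewrite -uV => -[A VA Ax].
  have VSA : VS A by split => //; exists x.
  by exists A => //; exact: (kP A VSA).2.
have /infiniteP/pcard_leP[f] := iVS.
have /choice[x xP] n : exists x, f n x /\ S x.
  have [_ [x [fx Sx]]] : VS (f n) by exact: (@funS _ _ _ _ f n I).
  by exists x.
exists x; split => [n|K cK]; first exact: (xP n).2.
have fV := locally_finite_compact lfV cK.
apply: (@sub_finite_set _ _ (f @^-1` [set A | V A /\ A `&` K !=set0])).
  move=> n /= Kx; have [Vf _] : VS (f n) by exact: (@funS _ _ _ _ f n I).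
  by split => //; exists (x n); split => //; exact: (xP n).1.
by apply: finite_preimage fV => m n _ _; apply: 'inj_f; rewrite inE.
Qed.

Definition has_compact_nbhs : Prop :=
  forall x : T, exists2 K, compact K & nbhs x K.

(** Near coverings with respect to the filter of finite sequences of indices ordered by
   inclusion. *)
Lemma compact_finite_subcover (I : choiceType) (D : set I) (V : I -> set T) K :
  compact K -> (forall x, K x -> exists2 i, D i & nbhs x (V i)) ->
  exists2 s : seq I, (forall i, i \in s -> D i) &
    K `<=` \bigcup_(i in [set` s]) V i.
Proof.
move=> /compact_near_coveringP cK DV.
pose F : set_system (seq I) := [set P : set (seq I) |
  exists2 s : seq I, (forall i, i \in s -> D i) &
    forall s' : seq I, {subset s <= s'} -> P s'].
have FF : Filter F.
  split; first by exists [::].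
    move=> P Q [s sD sP] [t tD tQ]; exists (s ++ t).
      by move=> i; rewrite mem_cat => /orP[/sD|/tD].
    move=> s' ss'; split; [apply: sP|apply: tQ] => u us;
    by apply: ss'; rewrite mem_cat us ?orbT.
  by move=> P Q PQ [s sD sP]; exists s => // s' /sP/PQ.
have [x Kx|s sD sK] := cK _ F (fun s y => (\bigcup_(i in [set` s]) V i) y) FF.
  have [i Di Vx] := DV x Kx.
  exists (V i, [set s : seq I | i \in s]); last by move=> [y s] /= [Vy si]; exists i.
  split => //; exists [:: i] => [j|s']; first by rewrite inE => /eqP->.
  by apply; exact: mem_head.
by exists s => //; exact: (sK s (fun _ => id)).
Qed.

Lemma compact_fattening K : has_compact_nbhs -> compact K ->
  exists2 K', compact K' & K `<=` interior K'.
Proof.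
move=> lcT cK.
have /choice[k kP] (x : T) : exists K, compact K /\ nbhs x K.
  by have [L cL Lx] := lcT x; exists L.
have [|s _ sK] := @compact_finite_subcover T setT (fun x => interior (k x)) K cK.
  by move=> x _; exists x => //; apply/nbhs_interior; exact: (kP x).2.
exists (\bigcup_(x in [set` s]) k x).
  apply: finite_bigcup_compact => [|x _]; last exact: (kP x).1.
  exact: finite_seq.
move=> y /sK[x sx ky]; apply: interiorS ky => z kz; by exists x.
Qed.

Lemma relcompact_cover_paracompact :
  paracompact T -> locally_compact [set: T] -> exists V, relcompact_cover V.
Proof.
move=> pT lcT.
have [|V [[Vo uV] VU Vlf]] := pT [set O | open O /\
    exists2 K, compact K & O `<=` K].
  split; first by move=> O [].
  apply/seteqP; split => // x _.
  have [K Kx [cK _]] := lcT x I.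
  exists (interior K).
    split; first exact: open_interior.
    by exists K => //; exact: interior_subset.
  have {}Kx : nbhs x [set y | setT y -> K y] by exact: Kx.
  by rewrite /interior; apply: filterS Kx => y; apply.
exists (V `\` [set set0]); split.
- apply/seteqP; split => // x _; have : setT x by [].
  rewrite -uV => -[A VA Ax]; exists A => //; split => // A0.
  by rewrite A0 in Ax.
- by move=> A [_ A0]; apply/set0P/eqP.
- by move=> A [/VU[W [_ [K cK WK]] AW] _]; exists K => //; exact: subset_trans WK.
- move=> x; have [N Nx fN] := Vlf x; exists N => //.
  by apply: sub_finite_set fN => A [[VA _] AN].
Qed.

Lemma has_compact_nbhs_locally_compact :
  locally_compact [set: T] -> has_compact_nbhs.
Proof.
move=> lcT x; have [K Kx [cK _]] := lcT x I; exists K => //.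
have {}Kx : nbhs x [set y | setT y -> K y] by exact: Kx.
by apply: filterS Kx => y; apply.
Qed.

Section Metrizable.
Context {R : realType}.

(** A short substitute for Stone's theorem in the locally compact case. The radius
   c x, the largest one (at most 1) for which balls around x are relatively compact,
   is 1-Lipschitz and positive. A maximal set D of points x, y at mutual distance at
   least max (c x) (c y) / 4 gives balls of radius c x / 3 that cover by maximality,
   and D meets each compact set in a finite set because it is locally separated. *)
Lemma relcompact_cover_metrizable :
  metrizable R T -> has_compact_nbhs -> exists V, relcompact_cover V.
Proof.
move=> [d [d0 dC dT dn]] lcT.
have dxx x : d x x = 0 by exact/d0.
have dge0 x y : 0 <= d x y.
  by have := dT x y x; rewrite dxx (dC y x); lra.
pose B x r := [set y | d x y < r].
have nB x r : 0 < r -> nbhs x (B x r) by move=> r0; apply/dn; exists r.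
pose G x := [set r : R | 0 <= r <= 1 /\ exists2 K, compact K & B x r `<=` K].
have G0 x : G x 0.
  split; first by rewrite lexx ler01.
  by exists set0 => [|y]; [exact: compact0|rewrite /B /= ltNge dge0].
have Gub x : ubound (G x) 1 by move=> r [/andP[]].
pose c x := sup (G x).
have Gc x r : G x r -> r <= c x.
  by move=> Gr; apply: ub_le_sup => //; exists 1; exact: Gub.
have cG x r : r < c x -> exists2 K, compact K & B x r `<=` K.
  move=> /(sup_gt (ex_intro _ 0 (G0 x)))[s [_ [K cK BK]] rs].
  by exists K => // y By; apply: BK; exact: lt_trans rs.
have c0 x : 0 < c x.
  have [K cK /dn[e e0 eK]] := lcT x.
  apply: (@lt_le_trans _ _ (Num.min e 1)).
    by rewrite lt_min e0 ltr01.
  apply: Gc; split.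
    by rewrite le_min (ltW e0) ler01 ge_min lexx orbT.
  by exists K => // y By; apply: eK; apply: lt_le_trans By _; rewrite ge_min lexx.
(* A ball around x is contained in a ball around y whose radius is larger by d x y. *)
have cL x y : c y <= c x + d x y.
  apply: ge_sup; first by exists 0.
  move=> r [/andP[r0 r1] [K cK BK]].
  have [rd|dr] := ltP r (d x y).
    by rewrite (le_trans (ltW rd))// lerDr ltW.
  rewrite -lerBlDr; apply: Gc; split.
    by rewrite subr_ge0 dr /= (le_trans _ r1)// lerBlDr lerDl.
  exists K => // z; rewrite /B /= => Bz; apply: BK; rewrite /B /=.
  by rewrite (le_lt_trans (dT y x z))// (dC y x); lra.
pose P (D : set T) := forall x y, D x -> D y -> x <> y ->
  Num.max (c x) (c y) / 4 <= d x y.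
have [D [PD Dmax]] : exists D, P D /\ forall D', D `<` D' -> ~ P D'.
  apply: Zorn_bigcup => F FP Ftot x y [X FX Xx] [Y FY Yy].
  by have [XY|YX] := Ftot _ _ FX FY;
    [apply: FP FY _ _ (XY _ Xx) Yy|apply: FP FX _ _ Xx (YX _ Yy)].
have Dclose x y : D x -> D y -> d x y < c x / 4 -> x = y.
  move=> Dx Dy dxy; apply: contrapT => /(PD _ _ Dx Dy).
  rewrite leNgt => /negP; apply; apply: lt_le_trans dxy _.
  by rewrite ler_pM2r ?invr_gt0// le_max lexx.
have Dlf : locally_finite D (fun x => [set x]).
  move=> z; exists (B z (c z / 16)); first by apply: nB; have := c0 z; lra.
  have [[x [Dx Bx]]|nD] := pselect (exists x, D x /\ B z (c z / 16) x).
    apply: (@sub_finite_set _ _ [set x]) => // y [Dy [_ [-> By]]] /=.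
    apply/esym/Dclose => //; move: Bx By; rewrite /B /= => Bx By.
    have := dT x z y; rewrite (dC x z).
    by have := c0 z; have := cL x z; rewrite (dC x z); lra.
  rewrite (_ : [set i | _] = set0)// -subset0 => y [Dy [_ [-> By]]].
  by apply: nD; exists y.
(* If y is not in D, maximality yields x in D with d x y < max (c x) (c y) / 4, and
   then d x y < c x / 3 because c y <= c x + d x y. *)
exists [set B x (c x / 3) | x in D]; split.
- apply/seteqP; split => // y _.
  have [Dy|nDy] := pselect (D y).
    by exists (B y (c y / 3)); [exists y|rewrite /B /= dxx; have := c0 y; lra].
  have [[x [Dx dxy]]|nx] := pselect (exists x, D x /\ B x (c x / 3) y).
    by exists (B x (c x / 3)) => //; exists x.
  exfalso; have Px x : D x -> Num.max (c x) (c y) / 4 <= d x y.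
    move=> Dx; rewrite leNgt; apply/negP => dlt; apply: nx.
    exists x; split => //; rewrite /B /=; have h1 := cL x y; have h2 := c0 x.
    by move: dlt; case: (leP (c x) (c y)) => h3 h4; lra.
  apply: (Dmax (D `|` [set y])).
    split; first by move=> x Dx; left.
    by move=> /(_ y (or_intror erefl)).
  move=> x x' [Dx|->] [Dx'|->] // xx'; [exact: PD|exact: Px|].
  by rewrite dC maxC; exact: Px.
- by move=> _ [x Dx <-]; exists x; rewrite /B /= dxx; have := c0 x; lra.
- by move=> _ [x Dx <-]; apply: cG; have := c0 x; lra.
- move=> y; exists (B y (c y / 16)); first by apply: nB; have := c0 y; lra.
(* A ball of the family that meets B y (c y / 16) has its centre in this larger ball. *)
  have [K cK BK] : exists2 K, compact K & B y (c y * (3 / 4)) `<=` K.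
    by apply: cG; have := c0 y; lra.
  apply: (@sub_finite_set _ _ ((fun x => B x (c x / 3)) @`
      [set x | D x /\ [set x] `&` K !=set0])); last first.
    by apply: finite_image; exact: locally_finite_compact.
  move=> _ [[x Dx <-] [z [Bxz Byz]]]; exists x => //; split => //.
  exists x; split => //; apply: BK; move: Bxz Byz; rewrite /B /= => Bxz Byz.
  have := dT y z x; rewrite (dC z x); have := cL y x; have := c0 y; lra.
Qed.

End Metrizable.

End LocallyFinite.

(** * Real functions of class C^k on open subsets of R^n *)

Section Ck.
Context {R : realType}.

(** The partial derivatives are asked to agree on V with functions of class C^(k-1),
   so that no choice of values outside V is ever made. *)
Fixpoint Ck n (k : nat) (V : set 'rV[R]_n) (f : 'rV[R]_n -> R) : Prop :=
  (forall x, V x -> {for x, continuous f}) /\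
  if k is k'.+1 then
    forall i, exists2 g, Ck k' V g &
      forall x, V x -> is_derive x (delta_mx 0 i) f (g x)
  else True.

Lemma Ck_continuous n k (V : set 'rV[R]_n) f x :
  Ck k V f -> V x -> {for x, continuous f}.
Proof. by case: k => [|k] [fc _]; exact: fc. Qed.

Lemma Ck_leS n k (V : set 'rV[R]_n) f : Ck k.+1 V f -> Ck k V f.
Proof.
elim: k f => [|k IH] f [fc fd]; split => // i.
by have [g gC gd] := fd i; exists g => //; exact: IH.
Qed.

Lemma Ck_le n k l (V : set 'rV[R]_n) f : (k <= l)%N -> Ck l V f -> Ck k V f.
Proof.
move=> /subnK <-; elim: (l - k)%N => // m IH; rewrite addSn => /Ck_leS; exact: IH.
Qed.

Lemma Ck_sub n k (V W : set 'rV[R]_n) f : W `<=` V -> Ck k V f -> Ck k W f.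
Proof.
move=> WV; elim: k f => [|k IH] f [fc fd]; split.
- by move=> x /WV; exact: fc.
- by [].
- by move=> x /WV; exact: fc.
- move=> i; have [g gC gd] := fd i; exists g; first exact: IH.
  by move=> x /WV; exact: gd.
Qed.

Lemma Ck_ext n k (V : set 'rV[R]_n) f g : open V ->
  (forall x, V x -> f x = g x) -> Ck k V f -> Ck k V g.
Proof.
move=> oV fg fC.
have near x : V x -> \forall y \near x, f y = g y.
  by move=> Vx; apply: filterS (open_nbhs_nbhs (conj oV Vx)) => y /fg.
have cg x : V x -> {for x, continuous g}.
  move=> Vx; suff: g @ x --> f x by rewrite (fg x Vx).
  exact: cvg_trans (near_eq_cvg (near x Vx)) (Ck_continuous fC Vx).
case: k fC => [|k] [fc fd]; split => // i.
have [h hC hd] := fd i; exists h => // x Vx.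
exact: near_eq_is_derive (near x Vx) (hd x Vx).
Qed.

Lemma Ck_cst n k (V : set 'rV[R]_n) (c : R) : Ck k V (fun=> c).
Proof.
elim: k c => [|k IH] c; split => //; try by move=> x _; exact: cst_continuous.
by move=> i; exists (fun=> 0); [exact: IH|move=> x _; exact: is_derive_cst].
Qed.

Lemma CkD n k (V : set 'rV[R]_n) f g :
  Ck k V f -> Ck k V g -> Ck k V (fun x => f x + g x).
Proof.
elim: k f g => [|k IH] f g fC gC; (split; first by move=> x Vx;
  apply: (@continuousD _ R^o _ f g); 
    [exact: Ck_continuous fC _|exact: Ck_continuous gC _]) => //.
move=> i; have [f' f'C f'd] := fC.2 i; have [g' g'C g'd] := gC.2 i.
exists (fun x => f' x + g' x); first exact: IH.
by move=> x Vx; apply: is_deriveD; [exact: f'd|exact: g'd].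
Qed.

Lemma CkM n k (V : set 'rV[R]_n) f g :
  Ck k V f -> Ck k V g -> Ck k V (fun x => f x * g x).
Proof.
elim: k f g => [|k IH] f g fC gC; (split; first by move=> x Vx;
  apply: (@continuousM _ _ f g); 
    [exact: Ck_continuous fC _|exact: Ck_continuous gC _]) => //.
move=> i; have [f' f'C f'd] := fC.2 i; have [g' g'C g'd] := gC.2 i.
exists (fun x => f x * g' x + g x * f' x).
  by apply: CkD; apply: IH => //; exact: Ck_leS.
by move=> x Vx; apply: is_deriveM; [exact: f'd|exact: g'd].
Qed.

Lemma Ck_sum n k (V : set 'rV[R]_n) m (f : 'I_m -> 'rV[R]_n -> R) :
  (forall j, Ck k V (f j)) -> Ck k V (fun x => \sum_(j < m) f j x).
Proof.
move=> fC; elim: m f fC => [|m IH] f fC.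
  by under eq_fun do rewrite big_ord0; exact: Ck_cst.
under eq_fun do rewrite big_ord_recl.
by apply: CkD => //; exact: IH.
Qed.

Lemma Ck_coord n k (V : set 'rV[R]_n) i : Ck k V (fun x => x 0 i).
Proof.
have cc x : {for x, continuous (fun x : 'rV[R]_n => x 0 i)}.
  exact: coord_continuous.
case: k => [|k]; split => // j.
exists (fun=> (delta_mx 0 j : 'rV[R]_n) 0 i); first exact: Ck_cst.
move=> x _; apply: DeriveDef.
  exact/diff_derivable/differentiable_coord.
rewrite /derive; apply: lim_near_cst => //; near=> h.
rewrite /= !mxE addrK [LHS]mulKf//.
by near: h; exact: nbhs_dnbhs_neq.
Unshelve. all: by end_near. Qed.

Lemma is_derive_line n (f : 'rV[R]_n -> R) (y e : 'rV[R]_n) (t : R) (l : R) :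
  is_derive (y + t *: e) e f l -> is_derive t (1 : R) (fun s => f (y + s *: e)) l.
Proof.
have E : (fun h : R => h^-1 *: ((f \o shift (y + t *: e)) (h *: e) - f (y + t *: e)))
    = (fun h : R => h^-1 *: (((fun s : R => f (y + s *: e)) \o shift t) (h *: (1 : R))
       - f (y + t *: e))).
  apply/funext => h /=; rewrite [h *: 1]mulr1 scalerDl.
  by congr (_ *: (f _ - _)); rewrite addrCA.
move=> [dl <-]; apply: DeriveDef.
  by move: dl; rewrite /derivable E.
by rewrite /derive E.
Qed.

(** The mean value theorem on the segment from 0 to a, for a of either sign. *)
Lemma MVT_between (phi dphi : R -> R) (a : R) :
  (forall t : R, `|t| <= `|a| -> is_derive t (1 : R) phi (dphi t)) ->
  exists2 c, `|c| <= `|a| & phi a - phi 0 = dphi c * a.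
Proof.
move=> phid.
have phic (t : R) : `|t| <= `|a| -> {for t, continuous phi}.
  move=> /phid phit; apply/differentiable_continuous/derivable1_diffP.
  exact: ex_derive.
have [a0|a0] := leP 0 a.
  have [|||c] := @MVT_segment _ phi dphi 0 a => //.
  - move=> t; rewrite in_itv /= => /andP[t0 ta]; apply: phid.
    by rewrite !ger0_norm// ltW.
  - apply: continuous_in_subspaceT => t; rewrite inE/= in_itv /= => /andP[t0 ta].
    by apply: phic; rewrite !ger0_norm.
  - rewrite in_itv /= subr0 => /andP[c0 ca] E; exists c => //.
    by rewrite !ger0_norm.
have [|||c] := @MVT_segment _ phi dphi a 0.
- exact: ltW.
- move=> t; rewrite in_itv /= => /andP[ta t0]; apply: phid.
  by rewrite !ltr0_norm// lerN2 ltW.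
- apply: continuous_in_subspaceT => t; rewrite inE/= in_itv /= => /andP[ta t0].
  by apply: phic; rewrite ler0_norm// ltr0_norm// lerN2.
- rewrite in_itv /= sub0r => /andP[ca c0] E; exists c.
    by rewrite ler0_norm// ltr0_norm// lerN2.
  by rewrite -opprB E mulrN opprK.
Qed.

Lemma mx_norm_coord n (h : 'rV[R]_n) i : `|h 0 i| <= `|h|.
Proof.
rewrite [leRHS]/Num.Def.normr /= mx_normrE.
exact: (le_bigmax _ (fun i : 'I_1 * 'I_n => `|h i.1 i.2|) (0, i)).
Qed.

Lemma mx_norm_le n (h : 'rV[R]_n) e :
  0 <= e -> (forall i, `|h 0 i| <= e) -> `|h| <= e.
Proof.
move=> e0 he; rewrite [leLHS]/Num.Def.normr /= mx_normrE.
by apply: bigmax_le => // -[i j] _ /=; rewrite ord1.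
Qed.

(** Go from x to x + h by changing one coordinate at a time; the mean value theorem
   along each edge and continuity of the partial derivatives bound the error. *)
Lemma Ck1_differentiable n (V : set 'rV[R]_n) f x :
  open V -> Ck 1 V f -> V x -> differentiable f x.
Proof.
move=> oV [fc fd] Vx.
have /choice[g gP] i : exists g, Ck 0 V g /\
    forall x, V x -> is_derive x (delta_mx 0 i) f (g x).
  by have [g] := fd i; exists g.
pose L (h : 'rV[R]_n) : R := \sum_i h 0 i * g i x.
have Llin : linear L.
  move=> a u v; rewrite /L scaler_sumr -big_split /=; apply: eq_bigr => i _.
  by rewrite !mxE mulrDl -mulrA.
pose LM := GRing.isLinear.Build _ _ _ _ L Llin.
pose LL : {linear 'rV[R]_n -> R} := HB.pack L LM.
have Lc : continuous LL.
  move=> u; have : Ck 0 setT L.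
    by apply: Ck_sum => i; apply: CkM; [exact: Ck_coord|exact: Ck_cst].
  by move=> /Ck_continuous; exact.
suff H : f \o shift x = cst (f x) + LL +o_ (0 : 'rV[R]_n) id.
  by apply/diff_locallyP; rewrite (diff_unique Lc H).
apply/eqaddoP => e e0; pose e' := e / n.+1%:R.
have e'0 : 0 < e' by rewrite divr_gt0.
have [d d0 dV] : exists2 d : R, 0 < d & forall y, `|y| < d ->
    V (x + y) /\ forall i, `|g i (x + y) - g i x| <= e'.
  have : \forall y \near x, V y /\ forall i, `|g i x - g i y| <= e'.
    apply: filterI; first exact: open_nbhs_nbhs.
    apply: (@filter_forall _ 'I_n (fun i y => `|g i x - g i y| <= e') (nbhs x) _) => i.
    by have /(@cvgrPdist_le _ R^o)/(_ _ e'0) := Ck_continuous (gP i).1 Vx.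
  move=> /nbhs_ballP[d /= d0 dP]; exists d => // y yd.
  have [|Vy gy] := dP (x + y).
    by rewrite -ball_normE /= opprD addrA subrr sub0r normrN.
  by split => // i; rewrite distrC.
apply/nbhs_ballP; exists d => //= h.
rewrite -ball_normE /= sub0r normrN => hd.
(* The j-th vertex of the path from 0 to h along the coordinate directions. *)
pose p (j : nat) : 'rV[R]_n := \row_i (if (i < j)%N then h 0 i else 0).
have pS (j : 'I_n) : p j.+1 = p j + h 0 j *: delta_mx 0 j.
  apply/rowP => i; rewrite !mxE /= ltnS leq_eqVlt.
  have [->|ij] := eqVneq i j; first by rewrite eqxx ltnn add0r mulr1.
  by rewrite (inj_eq val_inj) (negbTE ij) /= mulr0 addr0.
have p0 : p 0%N = 0 by apply/rowP => i; rewrite !mxE.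
have pn : p n = h by apply/rowP => i; rewrite !mxE ltn_ord.
have pt (j : 'I_n) t : `|t| <= `|h 0 j| -> `|p j + t *: delta_mx 0 j| < d.
  move=> th; apply: le_lt_trans hd; apply: mx_norm_le => // i; rewrite !mxE /=.
  have [->|ij] := eqVneq i j.
    by rewrite ltnn add0r mulr1 (le_trans th)// mx_norm_coord.
  by rewrite mulr0 addr0; case: ifP => _; rewrite ?normr0 ?mx_norm_coord.
have step (j : 'I_n) :
    `|f (x + p j.+1) - f (x + p j) - h 0 j * g j x| <= e' * `|h|.
  have [t th|c ca E] := @MVT_between (fun t => f (x + p j + t *: delta_mx 0 j))
      (fun t => g j (x + p j + t *: delta_mx 0 j)) (h 0 j).
    apply: is_derive_line; apply: (gP j).2; rewrite -addrA.
    exact: (dV _ (pt j t th)).1.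
  move: E; rewrite scale0r addr0 -addrA -pS => ->.
  rewrite mulrC -mulrBr normrM mulrC; apply: ler_pM => //.
    by rewrite -addrA; exact: (dV _ (pt j c ca)).2.
  exact: mx_norm_coord.
have -> : (f \o shift x - (cst (f x) + LL)) h =
    \sum_(j < n) (f (x + p j.+1) - f (x + p j) - h 0 j * g j x).
  rewrite sumrB -(big_mkord xpredT (fun j => f (x + p j.+1) - f (x + p j))).
  rewrite (telescope_sumr (fun j => f (x + p j)))// pn p0 addr0.
  by rewrite !fctE /= opprD addrA [h + x]addrC.
apply: le_trans (ler_norm_sum _ _ _) _.
apply: (@le_trans _ _ (\sum_(j < n) e' * `|h|)); first exact: ler_sum.
rewrite sumr_const card_ord -mulrnAl ler_wpM2r// -mulr_natr /e'.
by rewrite -mulrA ler_piMr ?(ltW e0)// ler_pdivrMl// mulr1 ler_nat.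
Qed.

Lemma derive_comp (U V W : normedModType R) (F : U -> V) (f : V -> W) x v :
  differentiable F x -> differentiable f (F x) ->
  'D_v (f \o F) x = 'D_('D_v F x) f (F x).
Proof.
move=> dF df; rewrite !deriveE//; last exact: differentiable_comp.
by rewrite diff_comp.
Qed.

Lemma derive_partials n (f : 'rV[R]_n -> R) x v : differentiable f x ->
  'D_v f x = \sum_i v 0 i * 'D_(delta_mx 0 i) f x.
Proof.
move=> df; rewrite deriveE// {1}(row_sum_delta v) linear_sum.
by apply: eq_bigr => i _; rewrite linearZ deriveE.
Qed.

Definition Ck_map n m k (V : set 'rV[R]_n) (F : 'rV[R]_n -> 'rV[R]_m) :=
  forall j, Ck k V (fun x => F x 0 j).

Lemma Ck_map_continuous n m k (V : set 'rV[R]_n) (F : 'rV[R]_n -> 'rV[R]_m) x :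
  Ck_map k V F -> V x -> {for x, continuous F}.
Proof.
move=> FC Vx; apply/(@cvgrPdist_le _ _ _ _ (nbhs_filter x)) => e e0.
have : \forall y \near x, forall j, `|F x 0 j - F y 0 j| <= e.
  apply: (@filter_forall _ 'I_m (fun j y => `|F x 0 j - F y 0 j| <= e) (nbhs x) _) => j.
  by have /(@cvgrPdist_le _ R^o)/(_ _ e0) := Ck_continuous (FC j) Vx.
by apply: filterS => y Fxy; apply: mx_norm_le (ltW e0) _ => j; rewrite !mxE.
Qed.

Lemma Ck_map_differentiable n m (V : set 'rV[R]_n) (F : 'rV[R]_n -> 'rV[R]_m) x :
  open V -> Ck_map 1 V F -> V x -> differentiable F x.
Proof.
move=> oV FC Vx.
have -> : F = \sum_(j < m) (fun y => F y 0 j *: delta_mx 0 j).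
  by apply/funext => y; rewrite {1}(row_sum_delta (F y)) fct_sumE.
apply: differentiable_sum => j; apply: differentiableZl.
exact: Ck1_differentiable oV (FC j) Vx.
Qed.

(** By the chain rule the partial derivatives of f \o F are sums of products of
   functions of class C^k, by induction. *)
Lemma Ck_comp n m k (V : set 'rV[R]_n) (W : set 'rV[R]_m) F f :
  open V -> open W -> (forall x, V x -> W (F x)) ->
  Ck_map k V F -> Ck k W f -> Ck k V (f \o F).
Proof.
move=> oV oW VW; elim: k f => [|k IH] f FC fC; split => //; try by move=> x Vx;
  apply: continuous_comp; [exact: Ck_map_continuous FC Vx|
                           exact: Ck_continuous fC (VW _ Vx)].
have /choice[g gP] j : exists g, Ck k W g /\
    forall x, W x -> is_derive x (delta_mx 0 j) f (g x).
  by have [g] := fC.2 j; exists g.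
move=> i.
have /choice[G GP] j : exists G, Ck k V G /\
    forall x, V x -> is_derive x (delta_mx 0 i) (fun x => F x 0 j) (G x).
  by have [G] := (FC j).2 i; exists G.
exists (fun x => \sum_j G j x * g j (F x)).
  apply: Ck_sum => j; apply: CkM; first exact: (GP j).1.
  apply: IH; last exact: (gP j).1.
  by move=> l; exact: Ck_leS.
move=> x Vx.
have dF : differentiable F x.
  by apply: Ck_map_differentiable oV _ Vx => j; exact: Ck_le (FC j).
have df : differentiable f (F x) by exact: Ck1_differentiable oW (Ck_le _ fC) (VW _ Vx).
apply: DeriveDef; first exact/diff_derivable/differentiable_comp.
rewrite derive_comp// derive_partials//; apply: eq_bigr => j _.
rewrite derive_mx; last exact: diff_derivable.
rewrite mxE; congr (_ * _).
  by have := (GP j).2 x Vx => -[_].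
by have := (gP j).2 _ (VW _ Vx) => -[_].
Qed.

Lemma has_partial_is_derive n i (f : 'rV[R]_n -> R) x (l : R) :
  @has_partial R n R^o i f x l <-> is_derive x (delta_mx 0 i) f l.
Proof.
split=> [fl|[df <-]]; last exact: df.
by apply: DeriveDef; [apply/cvg_ex; exists l|exact: cvg_lim].
Qed.

Lemma le_order_le k l r : (k <= l)%N -> le_order l r -> le_order k r.
Proof. by case: r => //= m; exact: leq_trans. Qed.

Lemma Cr_on_Ck n r k (V : set 'rV[R]_n) (f : 'rV[R]_n -> R) :
  @Cr_on R n R^o r V f -> le_order k r -> Ck k V f.
Proof.
move=> [D [<- DD Dc]] kr.
suff H s : le_order (size s + k)%N r -> Ck k V (D s) by exact: (H [::]).
elim: k s {kr} => [|k IH] s sr.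
  by split => // x Vx; apply: Dc => //; rewrite addn0 in sr.
split=> [x Vx|i].
  by apply: Dc => //; apply: le_order_le sr; rewrite leq_addr.
exists (D (i :: s)); first by apply: IH; rewrite addSnnS.
move=> x Vx; apply/has_partial_is_derive/DD => //.
by apply: le_order_le sr; rewrite addnS ltnS leq_addr.
Qed.

Lemma Cr_on_coord n m r (V : set 'rV[R]_n) (F : 'rV[R]_n -> 'rV[R]_m) j :
  Cr_on r V F -> @Cr_on R n R^o r V (fun x => F x 0 j).
Proof.
have cc : continuous (fun y : 'rV[R]_m => y 0 j : R^o) by exact: coord_continuous.
move=> [D [<- DD Dc]]; exists (fun s x => D s x 0 j); split => //.
- move=> i s sr x Vx; rewrite /has_partial.
  rewrite (_ : diff_quot _ _ _ =
    (fun y : 'rV[R]_m => y 0 j) \o diff_quot (D s) x (delta_mx 0 i)).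
    apply: continuous_cvg; [exact: cc|exact: DD].
  by apply/funext => h; rewrite /diff_quot /= !mxE.
- move=> s sr x Vx.
  exact: (continuous_comp (Dc s sr x Vx) (cc _)).
Qed.

(** The iterated partial derivatives of the whole space serve as the witness D; on the
   open set V they agree with the local ones. *)
Lemma Ck_Cr_on n r (V : set 'rV[R]_n) (f : 'rV[R]_n -> R) : open V ->
  (forall k, le_order k r -> Ck k V f) -> @Cr_on R n R^o r V f.
Proof.
move=> oV fC.
pose D (s : seq 'I_n) := foldr (fun i g x => 'D_(delta_mx 0 i) g x) f s.
have DC s k : le_order (size s + k)%N r -> Ck k V (D s).
  elim: s k => [|i s IH] k /=; first exact: fC.
  rewrite addSnnS => /IH[_ /(_ i)[g gC gd]].
  by apply: Ck_ext oV _ gC => x Vx; have [_] := gd x Vx.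
exists D; split => //.
- move=> i s sr x Vx; apply/has_partial_is_derive.
  have [|_ /(_ i)[g gC gd]] := DC s 1%N; first by rewrite addn1.
  by have [d dg] := gd x Vx; apply: DeriveDef.
- by move=> s sr x Vx; apply: Ck_continuous (DC s 0%N _) Vx; rewrite addn0.
Qed.

End Ck.

(** * A smooth bump function on R^n *)

Section Bump.
Context {R : realType}.

(** The functions t^-m exp(-1/t), extended by 0 to t <= 0: a family whose linear span
   is stable under differentiation. *)
Definition flat_exp (m : nat) (t : R) : R :=
  if 0 < t then t^-1 ^+ m * expR (- t^-1) else 0.

(** Bounds 1/t^(m+1) by (m+1)! exp(1/t), a term of the exponential series. This gives
   continuity of the family at 0, and differentiability there since the difference
   quotient of one member at 0 is the next one. *)
Lemma flat_exp_le m t : `|flat_exp m t| <= (m.+1)`!%:R * `|t|.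
Proof.
rewrite /flat_exp; case: ifPn => [t0|_]; last by rewrite normr0 mulr_ge0.
have ti0 : 0 <= t^-1 by rewrite invr_ge0 ltW.
rewrite !ger0_norm ?(ltW t0)//; last by rewrite mulr_ge0 ?exprn_ge0 ?expR_ge0.
have := expR_ge1Dxn m ti0; set F := (_`!)%:R => h.
have F0 : 0 < F by rewrite ltr0n fact_gt0.
rewrite expRN ler_pdivrMr ?expR_gt0//.
have {}h : t^-1 ^+ m.+1 <= F * expR t^-1.
  by rewrite mulrC -ler_pdivrMr// (le_trans _ h)// lerDr.
rewrite mulrAC -ler_pdivrMr//; apply: le_trans h.
by rewrite exprSr.
Qed.

Lemma flat_exp_derive m t :
  is_derive t (1 : R) (flat_exp m) (flat_exp m.+2 t - m%:R * flat_exp m.+1 t).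
Proof.
have [t0|t0|<-] := ltrgtP 0 t.
- have near : \forall s \near t, s^-1 ^+ m * expR (- s^-1) = flat_exp m s.
    have : \forall s \near t, 0 < s by exact: lt_nbhsr.
    by apply: filterS => s s0; rewrite /flat_exp s0.
  apply: near_eq_is_derive near _; rewrite /flat_exp t0.
  have tn0 : t != 0 by rewrite gt_eqF.
  have dV : is_derive t (1 : R) (fun s : R => s^-1) (- t^-2).
    have := @is_deriveV R id t (1 : R) (1 : R) tn0 (is_derive_id _ _).
    by move=> h; apply: is_derive_eq h _; rewrite [LHS]mulr1.
  have dN := is_deriveN dV; rewrite opprK in dN.
  have dE := @is_derive1_comp R expR (fun s => - s^-1) t _ _ (is_derive_expR _) dN.
  have dX := is_deriveX m dV.
  have -> : (fun s : R => s^-1 ^+ m * expR (- s^-1)) =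
      (fun s : R => s^-1) ^+ m * (expR \o (fun s => - s^-1)).
    by apply/funext => s; rewrite exprfctE.
  apply: is_derive_eq (is_deriveM dX dE) _.
  rewrite /GRing.scale /= !fctE; case: m {dX} => [|m] /=; set e := expR _.
    by rewrite exprVn; ring.
  by rewrite -!exprVn !exprS; ring.
- have near : \forall s \near t, 0 = flat_exp m s.
    have : \forall s \near t, s < 0 by exact: lt_nbhsl.
    by apply: filterS => s s0; rewrite /flat_exp ltNge (ltW s0).
  apply: near_eq_is_derive near _.
  rewrite /flat_exp ltNge (ltW t0) /= mulr0 subr0.
  exact: is_derive_cst.
- rewrite [X in is_derive _ _ _ X](_ : _ = 0); last first.
    by rewrite /flat_exp ltxx mulr0 subr0.
  suff H : (fun h : R => h^-1 *: ((flat_exp m \o shift (0 : R)) (h *: (1 : R))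
      - flat_exp m 0)) @ (0 : R)^' --> (0 : R).
    by apply: DeriveDef; [apply/cvg_ex; exists 0|exact: cvg_lim].
  have -> : (fun h : R => h^-1 *: ((flat_exp m \o shift (0 : R)) (h *: (1 : R))
      - flat_exp m 0)) = flat_exp m.+1.
    apply/funext => h /=; rewrite addr0 [h *: 1]mulr1 {2}/flat_exp ltxx subr0.
    rewrite /flat_exp; case: ifP => _; last exact: mulr0.
    by rewrite exprS -mulrA.
  apply/cvgrPdist_le => e e0; near=> h; rewrite sub0r normrN.
  apply: le_trans (flat_exp_le _ _) _; rewrite -ler_pdivlMl; last first.
    by rewrite ltr0n fact_gt0.
  near: h; apply: dnbhs0_le; rewrite mulr_gt0// invr_gt0 ltr0n fact_gt0//.
Unshelve. all: by end_near. Qed.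

Lemma flat_exp_Ck k m : @Ck R 1 k setT (fun y : 'rV[R]_1 => flat_exp m (y 0 0)).
Proof.
have fc m' (t : R) : {for t, continuous (flat_exp m')}.
  apply/differentiable_continuous/derivable1_diffP.
  by have [] := flat_exp_derive m' t.
have cc m' (y : 'rV[R]_1) : {for y, continuous (fun y : 'rV[R]_1 => flat_exp m' (y 0 0))}.
  exact: (continuous_comp (@coord_continuous _ _ _ 0 0 y) (fc _ _)).
elim: k m => [|k IH] m; split => // i.
exists (fun y : 'rV[R]_1 => flat_exp m.+2 (y 0 0) - m%:R * flat_exp m.+1 (y 0 0)).
  apply: CkD => //.
  apply: (@Ck_ext _ _ _ _ (fun y : 'rV[R]_1 => - m%:R * flat_exp m.+1 (y 0 0))) => //.
  - exact: openT.
  - by move=> x _; rewrite mulNr.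
  - by apply: CkM => //; exact: Ck_cst.
move=> y _; have [d dv] := flat_exp_derive m (y 0 0).
have E : (fun h : R => h^-1 *: (((fun y : 'rV[R]_1 => flat_exp m (y 0 0)) \o shift y)
        (h *: (delta_mx 0 i : 'rV[R]_1)) - flat_exp m (y 0 0))) =
    (fun h : R => h^-1 *: ((flat_exp m \o shift (y 0 0)) (h *: (1 : R)) -
      flat_exp m (y 0 0))).
  by apply/funext => h /=; rewrite !mxE ord1.
by apply: DeriveDef; [move: d|move: dv]; rewrite /derivable /derive E.
Qed.

Lemma flat_exp_gt0 t : (0 < flat_exp 0 t) = (0 < t).
Proof.
by rewrite /flat_exp expr0 mul1r; case: ifP => _; rewrite ?expR_gt0 ?ltxx.
Qed.

(** The function exp(-1/t) composed with e^2 - |x - a|^2 for the Euclidean norm, whose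
   balls lie in those of the sup norm. *)
Lemma bump_rV n (a : 'rV[R]_n) (e : R) : 0 < e ->
  exists f : 'rV[R]_n -> R, [/\ forall k, Ck k setT f, f a = 1
    & forall x, f x != 0 -> `|x - a| < e].
Proof.
move=> e0.
pose q (x : 'rV[R]_n) : R := e ^+ 2 - \sum_i (x 0 i - a 0 i) ^+ 2.
have qa : q a = e ^+ 2.
  by rewrite /q big1 ?subr0// => i _; rewrite subrr expr0n.
have c0 : flat_exp 0 (q a) != 0.
  by rewrite gt_eqF// flat_exp_gt0 qa exprn_gt0.
exists (fun x => (flat_exp 0 (q a))^-1 * flat_exp 0 (q x)); split.
- move=> k; apply: CkM; first exact: Ck_cst.
  apply: (Ck_ext _ (f := (fun y : 'rV[R]_1 => flat_exp 0 (y 0 0)) \o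
      (fun x => const_mx (q x)))) => //.
  + exact: openT.
  + by move=> x _ /=; rewrite mxE.
  apply: (@Ck_comp _ _ _ _ _ setT) => //; [exact: openT|exact: openT| |exact: flat_exp_Ck].
  move=> j; under eq_fun do rewrite mxE.
  apply: CkD; first exact: Ck_cst.
  apply: (Ck_ext _ (f := (fun x => -1 * \sum_i (x 0 i - a 0 i) * (x 0 i - a 0 i)))).
  + exact: openT.
  + by move=> x _; rewrite mulN1r; under eq_bigr do rewrite -expr2.
  apply: CkM; first exact: Ck_cst.
  by apply: Ck_sum => i; apply: CkM; (apply: CkD; [exact: Ck_coord|exact: Ck_cst]).
- exact: mulVf.
- move=> x; rewrite mulf_eq0 negb_or => /andP[_ fx].
  have qx : 0 < q x.
    by rewrite ltNge; apply: contra fx => qx; rewrite /flat_exp ltNge qx.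
  have xe i : `|(x - a) 0 i| < e.
    rewrite -(@ltr_pXn2r _ 2)// ?nnegrE ?(ltW e0)// real_normK ?num_real//.
    rewrite !mxE; move: qx; rewrite subr_gt0; apply: le_lt_trans.
    by rewrite (bigD1 i)//= lerDl sumr_ge0// => j _; exact: sqr_ge0.
  rewrite [ltLHS]/Num.Def.normr /= mx_normrE; apply: bigmax_lt => //.
  by move=> -[i j] _ /=; rewrite ord1.
Qed.

End Bump.

(** * Atlases of class C^s and the tangent bundle *)

Section Atlas.
Context {R : realType}.
Implicit Types X : charted R.

(** The part of a C^s-manifold structure that passes to the tangent bundle. Openness of
   the chart images of overlaps stands in for continuity of the inverse charts. *)
Definition Ck_atlas (s : nat) X : Prop :=
  [/\ forall x : X, dom (chart_at x) x,
      forall i j : Defs.index X, open (dom i) /\ open (chart i @` (dom i `&` dom j)),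
      forall (i : Defs.index X) x, dom i x -> chart_inv i (chart i x) = x,
      forall (i : Defs.index X) x, dom i x -> {for x, continuous (chart i)}
    & forall i j : Defs.index X,
        Ck_map s (chart i @` (dom i `&` dom j)) (chart j \o chart_inv i)].

Definition Ck_fun (s : nat) X (f : X -> R) : Prop :=
  forall i : Defs.index X, Ck s (chart i @` dom i) (f \o chart_inv i).

Lemma Cr_manifold_atlas r s X :
  Cr_manifold r X -> le_order s r -> Ck_atlas s X.
Proof.
move=> [cat cop cinv ccont ctr] sr; split => //.
- move=> i j; split; first exact: (cop i).1.
  rewrite openE => _ [x [ix jx] <-].
  have nj : nbhs (chart i x) (chart_inv i @^-1` dom j).
    apply: (ccont i x ix).2; rewrite cinv//.
    by apply: open_nbhs_nbhs; split => //; exact: (cop j).1.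
  have ni : nbhs (chart i x) (chart i @` dom i).
    by apply: open_nbhs_nbhs; split; [exact: (cop i).2|exists x].
  rewrite /interior; apply: filterS (filterI nj ni) => y [yj [z iz zy]].
  by move: yj; rewrite -zy /= cinv// => jz; exists z.
- by move=> i x ix; exact: (ccont i x ix).1.
- by move=> i j l; apply: Cr_on_Ck sr; apply: Cr_on_coord; exact: ctr.
Qed.

Lemma Ck_atlas_open s X (i : Defs.index X) : Ck_atlas s X -> open (chart i @` dom i).
Proof. by move=> [_ /(_ i i)[_]]; rewrite setIid. Qed.

Lemma Ck_fun_continuous s X (f : X -> R) :
  Ck_atlas s X -> Ck_fun s f -> continuous f.
Proof.
move=> [cat cop cinv ccont ctr] fC x.
set i := chart_at x; have ix : dom i x by exact: cat.
have xi : (chart i @` dom i) (chart i x) by exists x.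
have gc := continuous_comp (ccont i x ix) (Ck_continuous (fC i) xi).
have near : \forall y \near x, ((f \o chart_inv i) \o chart i) y = f y.
  apply: filterS (open_nbhs_nbhs (conj (cop i i).1 ix)) => y iy /=.
  by rewrite cinv.
suff : f @ x --> ((f \o chart_inv i) \o chart i) x by rewrite /= cinv.
exact: cvg_trans (near_eq_cvg near) gc.
Qed.

Lemma dir_deriveE n (f : 'rV[R]_n -> R) x v :
  derivable f x v -> @dir_derive R n R^o f x v = 'D_v f x.
Proof.
move=> df; apply: xget_unique; first exact: df.
by move=> l fl; apply/esym; apply: cvg_lim.
Qed.

(** The derivative of f at x in the direction v is linear in v with coefficients of
   class C^s in x. *)
Lemma Ck_tangent n s (V : set 'rV[R]_n) f : open V -> Ck s.+1 V f ->
  Ck s [set y : 'rV[R]_(n + n) | V (lsubmx y)]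
    (fun y => 'D_(rsubmx y) f (lsubmx y)).
Proof.
move=> oV fC.
have oV' : open [set y : 'rV[R]_(n + n) | V (lsubmx y)].
  by apply: open_comp oV => y _; exact: continuous_lsubmx.
have /choice[g gP] i : exists g, Ck s V g /\
    forall x, V x -> is_derive x (delta_mx 0 i) f (g x).
  by have [g] := fC.2 i; exists g.
apply: (Ck_ext oV' (f := fun y => \sum_i y 0 (rshift n i) * g i (lsubmx y))).
  move=> y Vy; rewrite derive_partials; last first.
    by apply: Ck1_differentiable oV _ Vy; exact: Ck_le fC.
  apply: eq_bigr => i _; rewrite mxE.
  by have [_ ->] := (gP i).2 _ Vy.
apply: Ck_sum => i; apply: CkM; first exact: Ck_coord.
apply: (@Ck_comp _ _ _ _ _ _ lsubmx _ oV' oV _ _ (gP i).1) => // j.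
have -> : (fun x : 'rV[R]_(n + n) => lsubmx x 0 j) = fun x => x 0 (lshift n j).
  by apply/funext => x; rewrite mxE.
exact: Ck_coord.
Qed.

Section TangentAtlas.
Context (X : charted R) (s : nat) (hX : Ck_atlas s.+1 X).
Implicit Types i j k : Defs.index X.

Let tr i j := chart j \o chart_inv i.

Let cat (x : X) : dom (chart_at x) x. Proof. by case: hX. Qed.
Let cop i j : open (chart i @` (dom i `&` dom j)).
Proof. by have [_ /(_ i j)[]] := hX. Qed.
Let cinv i x : dom i x -> chart_inv i (chart i x) = x.
Proof. by case: hX => _ _ + _ _; exact. Qed.

Lemma change_chart_id i x v : dom i x -> change_chart i i x v = v.
Proof.
move=> ix; rewrite /change_chart.
rewrite (@near_eq_derive _ _ _ _ id) ?derive_id//.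
apply: filterS (open_nbhs_nbhs (conj (@cop i i) _)) => [_ [y [iy _] <-] /=|].
  by rewrite cinv.
by exists x.
Qed.

Lemma trans_differentiable i j x : dom i x -> dom j x ->
  differentiable (tr i j) (chart i x).
Proof.
move=> ix jx; apply: (Ck_map_differentiable (@cop i j)); last by exists x.
by move=> l; apply: Ck_le (_ : Ck s.+1 _ _) => //; case: hX => _ _ _ _; exact.
Qed.

Lemma near_chart i j x : dom i x -> dom j x ->
  \forall y \near chart i x, exists2 z, dom i z /\ dom j z & y = chart i z.
Proof.
move=> ix jx; apply: filterS (open_nbhs_nbhs (conj (@cop i j) _)).
  by move=> _ [z iz <-]; exists z.
by exists x.
Qed.

(** The chain rule for the transition maps. *)
Lemma change_chart_comp i j k x v : dom i x -> dom j x -> dom k x ->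
  change_chart j k x (change_chart i j x v) = change_chart i k x v.
Proof.
move=> ix jx kx; rewrite /change_chart -/(tr j k) -/(tr i j) -/(tr i k).
have E : chart j x = tr i j (chart i x) by rewrite /tr /= cinv.
rewrite E -derive_comp; [|exact: trans_differentiable|]; last first.
  by rewrite -E; exact: trans_differentiable.
apply: near_eq_derive.
near=> y.
have [z [iz jz] ->] : exists2 z, dom i z /\ dom j z & y = chart i z.
  by near: y; exact: near_chart.
by rewrite /tr /= !cinv.
Unshelve. all: by end_near. Qed.

Lemma change_chartK i j x v : dom i x -> dom j x ->
  change_chart j i x (change_chart i j x v) = v.
Proof. by move=> ix jx; rewrite change_chart_comp// change_chart_id. Qed.

(** Any vector is reached, since the changes of coordinates are invertible. *)
Lemma tchart_image i j :
  tchart i @` (tdom i `&` tdom j) =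
  [set y | (chart i @` (dom i `&` dom j)) (lsubmx y)].
Proof.
apply/seteqP; split => [_ [w [iw jw] <-]|y [x [ix jx] xE]] /=.
  by rewrite row_mxKl; exists (foot w).
have E : chart_inv i (lsubmx y) = x by rewrite -xE cinv.
exists (tchart_inv i y); first by rewrite /tdom /= E.
rewrite /tchart /tchart_inv /= E change_chartK// xE; exact: hsubmxK.
Qed.

Lemma tchartK i (w : tvec X) : tdom i w -> tchart_inv i (tchart i w) = w.
Proof.
move=> iw; rewrite /tchart_inv /tchart row_mxKl row_mxKr cinv// change_chartK//.
by case: w iw.
Qed.

Lemma open_tchart i (O : set 'rV[R]_(Defs.dim X + Defs.dim X)) : open O ->
  open (tdom i `&` tchart i @^-1` O : set (tvec X)).
Proof.
move=> oO; set C := tdom i `&` _.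
exists [set C]; last by rewrite bigcup_set1.
move=> _ ->; exists (finmap.fset1 C); last by rewrite set_fset1 bigcap_set1.
by move=> x; rewrite finmap.inE => /eqP ->; apply/mem_set; exists i, O.
Qed.

(** The transition maps of the tangent bundle are (x, v) |-> (T x, D_v T x) for
   transition maps T of class C^(s+1). *)
Lemma tangent_atlas : Ck_atlas s (tangent X).
Proof.
split => /=.
- by move=> w; exact: cat.
- move=> i j; split; last first.
    rewrite tchart_image; apply: open_comp (@cop i j) => y _.
    exact: continuous_lsubmx.
  by have := open_tchart i openT; rewrite preimage_setT setIT.
- exact: tchartK.
- move=> i w iw A; rewrite nbhsE => -[W [oW Ww] WA].
  apply: filterS (open_nbhs_nbhs (conj (open_tchart i oW) (conj iw Ww))).
  by move=> z [_ /WA].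
- move=> i j; rewrite tchart_image => l.
  have [k ->|k ->] := split_ordP l.
    apply: (Ck_ext _ (f := (fun x => tr i j x 0 k) \o lsubmx)) => [|y _ /=|].
    + apply: open_comp (@cop i j) => y _; exact: continuous_lsubmx.
    + by rewrite /tchart row_mxEl.
    + apply: (@Ck_comp _ _ _ _ _ (chart i @` (dom i `&` dom j))) => //.
      * apply: open_comp (@cop i j) => y _; exact: continuous_lsubmx.
      * move=> m; have -> : (fun x : 'rV[R]_(Defs.dim X + Defs.dim X) => lsubmx x 0 m) =
            fun x => x 0 (lshift (Defs.dim X) m) by apply/funext => x; rewrite mxE.
        exact: Ck_coord.
      * by apply: Ck_leS; case: hX => _ _ _ _; exact.
  have ctr : Ck s.+1 (chart i @` (dom i `&` dom j)) (fun x => tr i j x 0 k).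
    by case: hX => _ _ _ _; exact.
  apply: Ck_ext (Ck_tangent (@cop i j) ctr).
    apply: open_comp (@cop i j) => y _; exact: continuous_lsubmx.
  move=> y [x [ix jx] xy] /=; rewrite /tchart row_mxEr /tchart_inv /= -xy cinv//.
  rewrite change_chart_comp// /change_chart -/(tr i j).
  by rewrite derive_mx ?mxE//; exact/diff_derivable/trans_differentiable.
Qed.

(** The preferred chart used to define the differential can be replaced by any other
   chart, by the chain rule. *)
Lemma Ck_fun_tangent (f : X -> R^o) : Ck_fun s.+1 f ->
  @Ck_fun s (tangent X) (@tangent_map2 R R^o X f).
Proof.
move=> fC; change (forall i : Defs.index X,
  @Ck R (Defs.dim X + Defs.dim X) s (@chart R (tangent X) i @` @dom R (tangent X) i)
    (@tangent_map2 R R^o X f \o @chart_inv R (tangent X) i)) => i.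
have oi j : open (chart j @` dom j) by exact: Ck_atlas_open hX.
have -> : @chart R (tangent X) i @` @dom R (tangent X) i =
    [set y : 'rV[R]_(Defs.dim X + Defs.dim X) |
       (@chart R X i @` @dom R X i) (lsubmx y)].
  by have := tchart_image i i; rewrite !setIid.
apply: Ck_ext (Ck_tangent (oi i) (fC i)).
  apply: open_comp (oi i) => y _; exact: continuous_lsubmx.
move=> y [x ix xy] /=; rewrite /tangent_map2 /= -xy cinv//.
set c := chart_at x; have cx : dom c x by exact: cat.
have fd j : dom j x -> differentiable (f \o chart_inv j) (chart j x).
  move=> jx; apply: (Ck1_differentiable (oi j)); last by exists x.
  exact: Ck_le (fC j).
rewrite dir_deriveE; last exact/diff_derivable/fd.
rewrite /change_chart -/(tr i c).
have E : chart c x = tr i c (chart i x) by rewrite /tr /= cinv.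
rewrite E -derive_comp; [|exact: trans_differentiable|by rewrite -E; exact: fd].
apply: near_eq_derive; near=> z.
have [t [it ct] ->] : exists2 t, dom i t /\ dom c t & z = chart i t.
  by near: z; exact: near_chart.
by rewrite /tr /= !cinv.
Unshelve. all: by end_near. Qed.

End TangentAtlas.

Lemma iter_tangent_atlas k s X (f : X -> R^o) :
  Ck_atlas (k + s)%N X -> Ck_fun (k + s)%N f ->
  Ck_atlas s (iter k (@tangent R) X) /\
  @Ck_fun s (iter k (@tangent R) X) (@iter_d_manifold R R^o X f k).
Proof.
elim: k s => [|k IH] s //; rewrite addSnnS => Xa fC.
have [ka kf] := IH s.+1 Xa fC.
by split; [exact: tangent_atlas ka|exact: Ck_fun_tangent].
Qed.

(** By induction on k: if f is of class C^k, then d^k f is of class C^0 on T^k M. *)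
Lemma iter_d_continuous r k X (f : X -> R^o) : Cr_manifold r X ->
  @Cr_prop R R^o r (Manifold X) f -> le_order k r ->
  continuous (@iter_d_manifold R R^o X f k : iter k (@tangent R) X -> R).
Proof.
move=> rX fC kr; have [||Xa fa] := @iter_tangent_atlas k 0 X f.
- by apply: Cr_manifold_atlas rX _; rewrite addn0.
- by move=> i; apply: Cr_on_Ck (fC i) _; rewrite addn0.
exact: Ck_fun_continuous Xa fa.
Qed.

End Atlas.

(** * Compactly supported bump functions on M *)

Lemma metrizable_hausdorff (R : realType) (T : topologicalType) :
  metrizable R T -> hausdorff_space T.
Proof.
move=> [d [d0 dC dT dn]] p q pq; apply/d0/eqP; rewrite eq_le; apply/andP.
have dge0 : 0 <= d p q.
  by have := dT p q p; rewrite (d0 p p).2// (dC q p); lra.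
split=> //; rewrite leNgt; apply/negP => dpq.
have nB x : nbhs x [set y | d x y < d p q / 2] by apply/dn; exists (d p q / 2) => //; lra.
have [z [/= pz qz]] := pq _ _ (nB p) (nB q).
by have := dT p z q; rewrite (dC z q); lra.
Qed.

Section Union.
Context {R : realType} {n : nat}.

(** The global directional derivative is used as a witness: on each of the two open
   sets it agrees with the local one. *)
Lemma Ck_setU k (A B : set 'rV[R]_n) f : open A -> open B ->
  Ck k A f -> Ck k B f -> Ck k (A `|` B) f.
Proof.
move=> oA oB; elim: k f => [|k IH] f fA fB; (split;
  first by move=> x [Ax|Bx];
    [exact: Ck_continuous fA Ax|exact: Ck_continuous fB Bx]) => // i.
have [g gC gd] := fA.2 i; have [h hC hd] := fB.2 i.
exists (fun x => 'D_(delta_mx 0 i) f x).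
  apply: IH.
    by apply: Ck_ext oA _ gC => x Ax; have [_] := gd x Ax.
  by apply: Ck_ext oB _ hC => x Bx; have [_] := hd x Bx.
by move=> x [/gd|/hd] [df _]; apply: DeriveDef.
Qed.

Lemma compact_norm_ball (a : 'rV[R]_n) e : 0 < e ->
  compact [set x | `|a - x| <= e].
Proof.
move=> e0; have -> : [set x | `|a - x| <= e] = closed_ball a e by rewrite closed_ballE.
apply: bounded_closed_compact; last exact: closed_ball_closed.
rewrite closed_ballE//; exists (`|a| + e); split; first exact: num_real.
move=> M aM x /= xe; apply: le_trans (ltW aM).
rewrite -[x](subKr a) (le_trans (ler_normB _ _))// lerD2l.
exact: xe.
Qed.

End Union.

Section ManifoldTopology.
Context {R : realType} (r : option nat) (X : charted R) (rX : Cr_manifold r X).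

Lemma chart_ball (x : X) : exists2 e, 0 < e &
  compact (chart_inv (chart_at x) @` [set y | `|chart (chart_at x) x - y| <= e]) /\
  [set y | `|chart (chart_at x) x - y| <= e] `<=` chart (chart_at x) @` dom (chart_at x).
Proof.
have [cat cop cinv ccont ctr] := rX.
set i := chart_at x; have ix : dom i x by exact: cat.
have ni : nbhs (chart i x) (chart i @` dom i).
  by apply: open_nbhs_nbhs; split; [exact: (cop i).2|exists x].
have /nbhs_ballP[e /= e0 eV] := ni.
have sub : [set y | `|chart i x - y| <= e / 2] `<=` chart i @` dom i.
  move=> y /= ye; apply: eV; rewrite -ball_normE /=.
  by apply: le_lt_trans ye _; rewrite ltr_pdivrMr// ltr_pMr// ltr1n.
exists (e / 2); first exact: divr_gt0.
split => //; apply: continuous_compact; last exact/compact_norm_ball/divr_gt0.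
apply: continuous_in_subspaceT => y; rewrite inE => /sub[z iz <-].
exact: (ccont i z iz).2.
Qed.

Lemma manifold_compact_nbhs : @has_compact_nbhs X.
Proof.
move=> x; have [e e0 [cK sub]] := chart_ball x.
have [cat cop cinv ccont ctr] := rX.
exists (chart_inv (chart_at x) @` [set y | `|chart (chart_at x) x - y| <= e]) => //.
have n1 : nbhs x (chart (chart_at x) @^-1` ball (chart (chart_at x) x) e).
  by apply: (ccont _ x (cat x)).1; exact: nbhsx_ballx.
have n2 := open_nbhs_nbhs (conj (cop (chart_at x)).1 (cat x)).
apply: filterS (filterI n1 n2) => y [/=]; rewrite -ball_normE /= => ye iy.
exists (chart (chart_at x) y); first exact: ltW.
exact: cinv.
Qed.

(** Transport a bump function by a chart and extend it by 0. In any other chart it is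
   of class C^r on the overlap and vanishes on the complement of a compact set, and
   these two open sets cover. *)
Lemma bump_manifold (x : X) : hausdorff_space X -> exists f : X -> R^o,
  [/\ @Cr_prop R R^o r (Manifold X) f, f x = 1 &
      exists2 K : set X, compact K & Defs.support f `<=` K].
Proof.
move=> hX; have [e e0 [cL sub]] := chart_ball x.
have [cat cop cinv ccont ctr] := rX.
set i := chart_at x in cL sub *; have ix : dom i x by exact: cat.
set L := chart_inv i @` _ in cL.
have clL : closed L by exact: compact_closed.
have [phi [phiC phi1 phis]] := bump_rV (chart i x) e0.
pose f (y : X) : R^o := if `[< dom i y >] then phi (chart i y) else 0.
have fL y : f y != 0 -> L y.
  rewrite /f; case: asboolP => [iy|_]; last by rewrite eqxx.
  move=> /phis ye; exists (chart i y); last exact: cinv.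
  by rewrite /= distrC ltW.
exists f; split; last first.
- exists L => //; rewrite /Defs.support closureE => y; apply; split => //.
- by rewrite /f asboolT.
move=> j; apply: Ck_Cr_on; first exact: (cop j).2.
move=> k kr; have at_k := Cr_manifold_atlas rX kr.
have oji : open (chart j @` (dom j `&` dom i)) by case: at_k => _ /(_ j i)[].
pose B := [set y | (chart j @` dom j) y /\ ~ L (chart_inv j y)].
have oB : open B.
  rewrite openE => _ [[y jy <-] nLy]; rewrite /interior.
  have n1 : nbhs (chart j y) (chart j @` dom j).
    by apply: open_nbhs_nbhs; split; [exact: (cop j).2|exists y].
  have n2 : nbhs (chart j y) (chart_inv j @^-1` (~` L)).
    apply: (ccont j y jy).2; apply: open_nbhs_nbhs; split => //.
    exact: closed_openC.
  exact: filterI n1 n2.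
apply: (@Ck_sub _ _ _ (chart j @` (dom j `&` dom i) `|` B)).
  move=> _ [y jy <-]; have [iy|niy] := pselect (dom i y); [left|right].
    by exists y.
  split; first by exists y.
  rewrite cinv// => -[z /= ze zy]; apply: niy; rewrite -zy.
  by have [t it <-] := sub z ze; rewrite cinv.
apply: Ck_setU => //.
  apply: (Ck_ext _ (f := phi \o (chart i \o chart_inv j))) => //.
    move=> _ [y [jy iy] <-] /=; rewrite /f cinv//; by rewrite asboolT.
  apply: (@Ck_comp _ _ _ _ _ setT) => //; first exact: openT.
  by case: at_k => _ _ _ _; exact.
apply: (Ck_ext _ (f := fun=> 0)) => //; last exact: Ck_cst.
move=> y [_ nL] /=; apply/esym/eqP; apply: contrapT => /negP /fL; exact: nL.
Qed.

End ManifoldTopology.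

Lemma bump_space (R : realType) (X : topologicalType) (x : X) :
  hausdorff_space X -> locally_compact [set: X] -> exists f : X -> R^o,
  [/\ continuous f, f x = 1 & exists2 K : set X, compact K & Defs.support f `<=` K].
Proof.
move=> hX lX.
have [K cK Kx] := has_compact_nbhs_locally_compact lX x.
have cB : closed (~` interior K) by apply: open_closedC; exact: open_interior.
have /(@uniform_separatorP _ R)[f [fc _ f0 f1]] : uniform_separator [set x] (~` interior K).
  by apply: (@locally_compact_completely_regular _ R) => //; apply; exact: Kx.
exists (fun y => 1 - f y); split.
- move=> y; apply: (@cvgB _ R^o); [exact: cvg_cst|exact: fc].
- by rewrite (f0 (f x)) ?subr0//; exists x.
- exists K => //; rewrite /Defs.support closureE => y; apply; split.
    exact: compact_closed.
  move=> z /= fz; apply: contrapT => nKz; move/negP: fz; apply; apply/eqP.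
  rewrite (f1 (f z)) ?subrr//; exists z => // /interior_subset; exact: nKz.
Qed.

(** * Differentials of a product with a fixed vector *)

Section LineLimits.
Context {R : realType} {E : tvsType R} (hE : hausdorff_space E).

Lemma hausdorff_seminorm (v : E) : v != 0 ->
  exists2 p, cont_seminorm p & 0 < p v.
Proof.
move=> v0; apply: contrapT => H.
have H0 p : cont_seminorm p -> p v = 0.
  move=> cp; apply/eqP; rewrite eq_le seminorm_ge0 ?andbT; last by case: cp.
  by rewrite leNgt; apply/negP => pv; apply: H; exists p.
move/eqP: v0; apply; apply: hE => A B Av B0.
exists v; split; first exact: nbhs_singleton.
have [p cp pB] := gauge B0.
by apply: pB => /=; rewrite H0.
Qed.

Lemma tvs_cvg_unique (T : Type) (F : set_system T) {FF : ProperFilter F}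
  (f : T -> E) (l m : E) : f @ F --> l -> f @ F --> m -> l = m.
Proof. by move=> fl fm; exact: (cvg_unique hE fl fm). Qed.

(** In a Hausdorff space the line through v carries the usual topology of R: a seminorm
   with p v > 0 makes the coefficients q x a Cauchy filter. *)
Lemma cvg_line (T : Type) (F : set_system T) {FF : ProperFilter F}
    (q : T -> R) (v l : E) : v != 0 ->
  (fun x => q x *: v) @ F --> l -> cvg (q @ F).
Proof.
move=> /hausdorff_seminorm[p cp pv] ql.
apply: cauchy_cvg; apply: cauchy_exP => e e0.
have ep : 0 < e / 2 * p v by rewrite mulr_gt0// divr_gt0.
have near_l : F [set x | p (q x *: v - l) < e / 2 * p v].
  have := cont_seminorm_ball cp ep => n0.
  have : nbhs l [set y | p (y - l) < e / 2 * p v].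
    apply/nbhs_translate; apply: filterS n0 => y /=.
    by rewrite addrAC subrr add0r.
  exact: ql.
have [x0 x0l] := filter_ex near_l.
exists (q x0); rewrite /= /nbhs /=; apply: filterS near_l => x xl /=.
rewrite -ball_normE /=.
have sp := cp.1.
rewrite -(@ltr_pM2r _ (p v))// -sp.2 scalerBl.
have -> : q x0 *: v - q x *: v = (q x0 *: v - l) + - (q x *: v - l).
  by rewrite opprB addrA subrK.
apply: le_lt_trans (sp.1 _ _) _; rewrite seminormN//.
by rewrite [e]splitr mulrDl; exact: ltrD.
Qed.

Lemma dir_derive_cvg n (f : 'rV[R]_n -> E) x w (l : E) :
  diff_quot f x w @ (0 : R)^' --> l -> dir_derive f x w = l.
Proof.
move=> fl; apply: xget_unique => // m fm.
exact: (@tvs_cvg_unique _ (0 : R)^' _ _ _ _ fm fl).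
Qed.

Lemma dir_derive_dvg n (f : 'rV[R]_n -> E) x w :
  (forall l : E, ~ diff_quot f x w @ (0 : R)^' --> l) -> dir_derive f x w = 0.
Proof. by move=> nf; apply: xgetPN => l; exact: nf. Qed.

End LineLimits.

Section DirDerive.
Context {R : realType} {E : tvsType R} (hE : hausdorff_space E).
Let hR : hausdorff_space R^o. Proof. exact: norm_hausdorff. Qed.

(** The difference quotients of f v converge if and only if those of f do, so this
   holds for every function f, of whatever regularity. *)
Lemma dir_derive_mul n (f : 'rV[R]_n -> R^o) (v : E) x w :
  dir_derive (fun y => f y *: v) x w = dir_derive f x w *: v.
Proof.
have E1 : diff_quot (fun y => f y *: v) x w = fun h => diff_quot f x w h *: v.
  by apply/funext => h; rewrite /diff_quot /= -scalerBl scalerA.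
have [[m fm]|nf] := pselect (exists m : R^o, diff_quot f x w @ (0 : R)^' --> m).
  rewrite (dir_derive_cvg hR fm); apply: dir_derive_cvg => //.
  by rewrite E1; exact: tvs_cvgZl.
rewrite (dir_derive_dvg (f := f)) ?scale0r => [|m fm]; last by apply: nf; exists m.
have [->|v0] := eqVneq v 0.
  apply: dir_derive_cvg => //.
  rewrite (_ : diff_quot _ _ _ = cst 0); first exact: cvg_cst.
  by apply/funext => h; rewrite /diff_quot /= !scaler0 subrr scaler0.
apply: dir_derive_dvg => l; rewrite E1 => fl.
have cq := @cvg_line R E hE R (0 : R)^' _ _ v l v0 fl.
by apply: nf; exists (lim (diff_quot f x w @ (0 : R)^')); exact: cq.
Qed.

Lemma dir_derive_scale n (g : 'rV[R]_n -> E) (a : R) x w : a != 0 ->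
  dir_derive (fun y => a *: g y) x w = a *: dir_derive g x w.
Proof.
have cZ b (f : 'rV[R]_n -> E) (l : E) : diff_quot f x w @ (0 : R)^' --> l ->
    diff_quot (fun y => b *: f y) x w @ (0 : R)^' --> b *: l.
  move=> fl; have -> : diff_quot (fun y => b *: f y) x w =
      b *: diff_quot f x w + (fun=> 0).
    apply/funext => h; rewrite !fctE addr0 /diff_quot /= -scalerBr !scalerA.
    by rewrite mulrC.
  by rewrite -[b *: l]addr0; apply: tvs_cvgZD => //; exact: cvg_cst.
move=> a0; have [[m gm]|ng] := pselect (exists m : E, diff_quot g x w @ (0 : R)^' --> m).
  by rewrite (dir_derive_cvg hE gm); apply: dir_derive_cvg => //; exact: cZ.
rewrite (dir_derive_dvg (f := g)) ?scaler0 => [|m gm]; last by apply: ng; exists m.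
apply: dir_derive_dvg => l /(cZ a^-1) gl; apply: ng; exists (a^-1 *: l).
have E1 : (fun y => a^-1 *: (a *: g y)) = g.
  by apply/funext => y; rewrite scalerA mulVf// scale1r.
by rewrite E1 in gl.
Qed.

End DirDerive.

Section IterD.
Context {R : realType} {E : tvsType R} (hE : hausdorff_space E) (M : domain R).

Lemma iter_d_mul (f : M -> R^o) (v : E) k :
  @iter_d R E M (fun x => f x *: v) k = fun y => @iter_d R R^o M f k y *: v.
Proof.
case: M f => [X|X] f //=; elim: k => //= k ->.
by apply/funext => w; exact: dir_derive_mul.
Qed.

Lemma iter_d_scale (a : R) (g : M -> E) k : a != 0 ->
  @iter_d R E M (fun x => a *: g x) k = fun y => a *: @iter_d R E M g k y.
Proof.
move=> a0; case: M g => [X|X] g //=; elim: k => //= k ->.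
by apply/funext => w; exact: dir_derive_scale.
Qed.

Lemma iter_d0 k : @iter_d R E M (fun=> 0) k = fun=> 0.
Proof.
have := iter_d_mul (fun=> 0) 0 k.
under eq_fun do rewrite scaler0.
by under [in RHS]eq_fun do rewrite scaler0.
Qed.

End IterD.

(** * Topology and calculus on admissible domains *)

Section IterDLinear.
Context {R : realType}.

Lemma tangent_map2_linear s (X : charted R) (a : R) (f g : X -> R^o) :
  Ck_atlas s.+1 X -> Ck_fun s.+1 f -> Ck_fun s.+1 g ->
  @tangent_map2 R R^o X (fun x => a * f x + g x) =
  fun w => a * @tangent_map2 R R^o X f w + @tangent_map2 R R^o X g w.
Proof.
move=> hX fC gC; apply/funext => w; rewrite /tangent_map2.
have [cat _ _ _ _] := hX; set i := chart_at _; have iw : dom i (foot w) by exact: cat.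
have dd (h : X -> R^o) : Ck_fun s.+1 h ->
    differentiable (h \o chart_inv i) (chart i (foot w)).
  move=> hC; apply: (Ck1_differentiable (Ck_atlas_open hX)); last by exists (foot w).
  exact: Ck_le (hC i).
have df := dd f fC; have dg := dd g gC.
have E1 : (fun x => a * f x + g x) \o chart_inv i =
  a *: (f \o chart_inv i) + (g \o chart_inv i) by exact/funext.
have daf : differentiable (a *: (f \o chart_inv i)) (chart i (foot w)).
  exact: differentiableZ.
rewrite E1 !dir_deriveE; try exact: diff_derivable.
  rewrite deriveD; try exact: diff_derivable.
  by rewrite deriveZ; last exact: diff_derivable.
by apply: diff_derivable; exact: differentiableD.
Qed.

Lemma iter_d_manifold_linear k s (X : charted R) (a : R) (f g : X -> R^o) :
  Ck_atlas (k + s)%N X -> Ck_fun (k + s)%N f -> Ck_fun (k + s)%N g ->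
  @iter_d_manifold R R^o X (fun x => a * f x + g x) k =
  fun y => a * @iter_d_manifold R R^o X f k y + @iter_d_manifold R R^o X g k y.
Proof.
elim: k s => [|k IH] s //; rewrite addSnnS => hX fC gC /=.
rewrite (IH _ hX fC gC).
have [kX kf] := iter_tangent_atlas hX fC.
have [_ kg] := iter_tangent_atlas hX gC.
exact: tangent_map2_linear kX kf kg.
Qed.

End IterDLinear.

Section Admissible.
Context {R : realType} {r : option nat} {M : domain R} (hM : admissible r M).

Lemma admissible_hausdorff : hausdorff_space M.
Proof. by case: M hM => X [] // _ _ + _; exact: metrizable_hausdorff. Qed.

Lemma admissible_compact_nbhs : @has_compact_nbhs M.
Proof.
case: M hM => X []; last by move=> _ + _ _; exact: manifold_compact_nbhs.
by move=> _ _ _ lX _; exact: has_compact_nbhs_locally_compact.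
Qed.

Lemma admissible_noncompact : ~ compact [set: M].
Proof. by case: M hM => X []. Qed.

Lemma admissible_cover : exists V, @relcompact_cover M V.
Proof.
have := admissible_compact_nbhs; case: M hM => X [].
  by move=> _ _ pX lX _ _; exact: relcompact_cover_paracompact.
by move=> _ _ mX _ lX; exact: relcompact_cover_metrizable mX lX.
Qed.

Lemma admissible_bump (x : M) : exists f : Crc r M R^o, Crc_val f x = 1.
Proof.
have [f [fr f1 fK]] : exists f : M -> R^o, [/\ Cr_prop r f, f x = 1 &
    exists2 K : set M, compact K & Defs.support f `<=` K].
  case: M hM x => X [].
    by move=> _ hX _ lX _ x; exact: bump_space.
  by move=> _ rX mX _ x; apply: bump_manifold => //; exact: metrizable_hausdorff mX.
have fC : f \in @Cr_pred R r M R^o by apply/asboolP.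
have fc : MkCr fC \in @Crc_pred R r M R^o by apply/asboolP.
by exists (MkCrc fc).
Qed.

Lemma admissible_iter_d_continuous (f : Cr r M R^o) k : le_order k r ->
  continuous (@iter_d R R^o M f k).
Proof.
case: f => f /asboolP /=; case: M hM f => X [].
  by move=> _ _ _ _ _ f.
by move=> _ rX _ _ f fr kr; exact: iter_d_continuous rX fr kr.
Qed.

(** Makes the sets of functions with |d^k f| < e on a compact set convex. *)
Lemma admissible_iter_d_linear (a : R) (f g : Cr r M R^o) k : le_order k r ->
  @iter_d R R^o M (a *: f + g) k =
  fun y => a * @iter_d R R^o M f k y + @iter_d R R^o M g k y.
Proof.
have /asboolP fr := Cr_funP f; have /asboolP gr := Cr_funP g.
have valE : Cr_fun (a *: f + g) = (fun x => a * f x + g x) by [].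
rewrite valE; move: (Cr_fun f) (Cr_fun g) fr gr => {valE f g}; case: M hM => X [].
  by move=> _ _ _ _ _ f g.
move=> _ rX _ _ f g fr gr kr /=.
apply: (@iter_d_manifold_linear _ k 0).
- by apply: Cr_manifold_atlas rX _; rewrite addn0.
- by move=> i; apply: Cr_on_Ck (fr i) _; rewrite addn0.
- by move=> i; apply: Cr_on_Ck (gr i) _; rewrite addn0.
Qed.

End Admissible.

(** * The topology of the steps *)

Section FixedSupport.
Context {R : realType} (r : option nat) (M : domain R) (E : tvsType R).
Context (hE : hausdorff_space E).

(** The compact-open topology at the function 0 is that of uniform convergence on
   compact sets. *)
Lemma CrK_cvg0 (K : set M) (F : set_system (CrK r E K)) : Filter F ->
  (forall k L (U : set E), le_order k r -> compact L -> nbhs (0 : E) U ->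
    F [set f | forall x, L x -> U (@iter_d R E M (Cr_fun (CrK_val f)) k x)]) ->
  F --> (0 : CrK r E K).
Proof.
move=> FF H A [_ [[B oB <-] B0] BA].
apply: (filterS BA); move: oB B0 => [C oC <-] C0.
have nC : nbhs (Cr_jet (0 : Cr r M E)) C by apply: open_nbhs_nbhs.
suff: (fun f : CrK r E K => Cr_jet (CrK_val f)) @ F --> Cr_jet (0 : Cr r M E).
  by move=> /(_ _ nC).
apply/cvg_sup => k; move=> D [_ [[W oW <-] W0] WD].
apply: (filterS WD) => {D WD}.
pose jet (f : Cr r M E) : {compact-open, iter_tangent (sval k) M -> E} :=
  @iter_d R E M f (sval k).
suff: (fun f : CrK r E K => jet (CrK_val f)) @ F --> jet 0.
  by apply; exact: open_nbhs_nbhs.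
apply/compact_open_cvgP => L V cL oV LV.
have Z : jet 0 = fun=> 0 by exact: iter_d0.
have [[x Lx]|nL] := pselect (L !=set0); last first.
  by apply: filterS filterT => f _ y [x Lx _]; exfalso; apply: nL; exists x.
have V0 : nbhs 0 V.
  apply: open_nbhs_nbhs; split => //; apply: LV; exists x => //.
  by rewrite Z.
have FV := H (sval k) L V (svalP k) cL V0.
apply: (@filterS _ F FF _ _ _ FV) => f /= fV _ [y Ly <-]; exact: fV.
Qed.

Lemma CrK_nbhs0 (K : set M) k L (U : set E) :
  le_order k r -> compact L -> nbhs (0 : E) U ->
  nbhs (0 : CrK r E K)
    [set f | forall x, L x -> U (@iter_d R E M (Cr_fun (CrK_val f)) k x)].
Proof.
move=> kr cL; rewrite nbhsE => -[V [oV V0] VU].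
pose kk : {k | le_order k r} := exist _ k kr.
have c1 : continuous (@CrK_val R r M E K : CrK r E K -> Cr r M E).
  exact: initial_continuous.
have c2 : continuous (@Cr_jet R r M E).
  exact: initial_continuous.
pose jet (f : Cr r M E) : {compact-open, iter_tangent k M -> E} := @iter_d R E M f k.
have nO : nbhs (jet 0)
    [set g : {compact-open, iter_tangent k M -> E} | g @` L `<=` V].
  apply: open_nbhs_nbhs; split; first exact: compact_open_open.
  have -> : jet 0 = fun=> 0 by exact: iter_d0.
  by move=> _ [x _ <-].
have c3 := @proj_continuous _ (fun k : {k | le_order k r} =>
   {compact-open, iter_tangent (sval k) M -> E} : topologicalType) kk
   (Cr_jet (0 : Cr r M E)) _ nO.
have N := c1 0 _ (c2 _ _ c3).
apply: (@filterS _ (nbhs (0 : CrK r E K)) _ _ _ _ N) => f fV x Lx.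
by apply: VU; apply: fV; exists x.
Qed.

End FixedSupport.

(** * The direct limit topology *)

Lemma CrK_valZ {R : realType} {r : option nat} {M : domain R} {E : tvsType R}
    (K : set M) (a : R) (f : CrK r E K) :
  Cr_fun (CrK_val (a *: f)) = fun x => a *: CrK_val f x.
Proof. by []. Qed.

Lemma Crc_valZ {R : realType} {r : option nat} {M : domain R} {E : tvsType R}
    (a : R) (f : Crc r M E) x : Crc_val (a *: f) x = a *: Crc_val f x.
Proof. by []. Qed.

Lemma CrK_eval_nbhs0 {R : realType} {r : option nat} {M : domain R}
    {E : tvsType R} (hE : hausdorff_space E) (K : set M) (x : M) (U : set E) :
  nbhs 0 U -> nbhs (0 : CrK r E K) [set f : CrK r E K | U (CrK_val f x)].
Proof.
have r0 : le_order 0 r by case: r.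
case: M K x => X K x U0; have := CrK_nbhs0 hE K r0 (@compact_set1 _ x) U0.
  by apply: (@filterS _ (nbhs (0 : @CrK R r (Defs.Space R X) E K))) => f; apply.
by apply: (@filterS _ (nbhs (0 : @CrK R r (Manifold X) E K))) => f; apply.
Qed.

Section DirectLimit.
Context {R : realType} {r : option nat} {M : domain R} {E : tvsType R}.
Context (hE : hausdorff_space E).
Implicit Types (K : set M) (f g : Crc r M E) (W V : set (Crc r M E)).

Lemma Crc_ext f g : (forall x, Crc_val f x = Crc_val g x) -> f = g.
Proof. by move=> fg; apply/val_inj/val_inj/funext. Qed.

Lemma CrK_ext K (f g : CrK r E K) :
  (forall x, CrK_val f x = CrK_val g x) -> f = g.
Proof. by move=> fg; apply/val_inj/val_inj/funext. Qed.

Lemma CrK_widen_subproof K K' (KK' : K `<=` K') (f : CrK r E K) :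
  CrK_val f \in @CrK_pred R r M E K'.
Proof. by have /asboolP fK := CrK_valP f; apply/asboolP; exact: subset_trans KK'. Qed.

Definition CrK_widen K K' (KK' : K `<=` K') (f : CrK r E K) : CrK r E K' :=
  MkCrK (CrK_widen_subproof KK' f).

Lemma nbhs0_scale (U : set E) (a : R) : a != 0 -> nbhs 0 U ->
  nbhs (0 : E) [set y | U (a *: y)].
Proof.
move=> a0 U0; have ai0 : a^-1 != 0 by rewrite invr_eq0.
apply: filterS (nbhs0Z ai0 U0) => _ [y Uy <-] /=.
by rewrite scalerA divff// scale1r.
Qed.

Lemma CrK_widen_scale_cvg0 K K' (KK' : K `<=` K') (a : R) : a != 0 ->
  (fun f : CrK r E K => a *: CrK_widen KK' f) @ (0 : CrK r E K) --> (0 : CrK r E K').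
Proof.
move=> a0; have FF : Filter
    ((fun f : CrK r E K => a *: CrK_widen KK' f) @ (0 : CrK r E K)).
  have F1 : Filter (nbhs (0 : CrK r E K)) by exact: nbhs_filter.
  exact: fmap_filter.
apply: (@CrK_cvg0 _ _ _ _ hE _ _ FF) => k L U kr cL U0.
have := CrK_nbhs0 hE K kr cL (nbhs0_scale a0 U0).
apply: (@filterS _ (nbhs (0 : CrK r E K))) => f fU x Lx.
change (U (@iter_d R E M (CrK_val (a *: CrK_widen KK' f)) k x)).
by rewrite CrK_valZ iter_d_scale//; exact: fU.
Qed.

Lemma CrK_scale_nbhs0 K (A : set (CrK r E K)) (a : R) : a != 0 ->
  nbhs (0 : CrK r E K) A -> nbhs (0 : CrK r E K) [set f : CrK r E K | A (a *: f)].
Proof.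
move=> a0 /(CrK_widen_scale_cvg0 (@subset_refl _ K) a0).
apply: (@filterS _ (nbhs (0 : CrK r E K))) => f /=.
by congr (A (a *: _)); exact: CrK_ext.
Qed.

Lemma lim_nbhs0_scale W (a : R) : a != 0 -> lim_nbhs0 W ->
  lim_nbhs0 [set f : Crc r M E | W (a *: f)].
Proof.
move=> a0 [/convex_setP Wc W0]; split.
  apply/convex_setP => t x y t01 Wx Wy /=.
  rewrite scalerDr !scalerA ![a * _]mulrC -!scalerA; exact: Wc.
move=> K cK; apply: (@filterS _ (nbhs (0 : CrK r E K))) (CrK_scale_nbhs0 a0 (W0 K cK)).
by move=> f /=; congr W; exact: Crc_ext.
Qed.

Lemma lim_nbhs0_0 W : lim_nbhs0 W -> W 0.
Proof.
move=> [_ /(_ set0 (@compact0 _))] /(@nbhs_singleton (CrK r E set0)) /=.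
by congr W; exact: Crc_ext.
Qed.

Lemma lim_nbhs0I V W : lim_nbhs0 V -> lim_nbhs0 W -> lim_nbhs0 (V `&` W).
Proof.
move=> [/convex_setP Vc V0] [/convex_setP Wc W0]; split; last first.
  by move=> K cK; apply: (@filterI _ (nbhs (0 : CrK r E K))); [exact: V0|exact: W0].
apply/convex_setP => t x y t01 [Vx Wx] [Vy Wy].
by split; [exact: Vc|exact: Wc].
Qed.

(** The set W / 2 works, by convexity of W. *)
Lemma lim_nbhs0_split W : lim_nbhs0 W ->
  exists2 V, lim_nbhs0 V & forall v w, V v -> V w -> W (v + w).
Proof.
move=> W0; have two0 : 2 != 0 :> R by [].
exists [set f : Crc r M E | W (2 *: f)]; first exact: lim_nbhs0_scale.
move=> v w Vv Vw; have [/convex_setP Wc _] := W0.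
have -> : v + w = 2^-1 *: (2 *: v) + (1 - 2^-1) *: (2 *: w).
  rewrite !scalerA mulVf// scale1r (_ : (1 - 2^-1) * 2 = 1) ?scale1r//.
  by field.
by apply: Wc => //; apply/andP; split; lra.
Qed.

(** The sets f + W generate the neighbourhoods: the interior of A consists of the g with
   g + V inside A for some V, as half of V shows. *)
Lemma nbhs_Crc f (A : set (Crc r M E)) :
  nbhs f A <-> exists2 W, lim_nbhs0 W & forall w, W w -> A (f + w).
Proof.
split=> [|[W W0 WA]].
  rewrite nbhsE => -[B [oB Bf] BA]; have [W W0 WB] := oB f Bf.
  by exists W => // w /WB /BA.
rewrite nbhsE; exists [set g | exists2 V, lim_nbhs0 V & forall w, V w -> A (g + w)].
  split; last by exists W.
  move=> g [V V0 VA]; have [V' V'0 V'V] := lim_nbhs0_split V0.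
  exists V' => // v V'v; exists V' => // w V'w.
  by rewrite -addrA; apply: VA; exact: V'V.
by move=> g [V V0 VA]; rewrite -[g]addr0; apply: VA; exact: lim_nbhs0_0.
Qed.

(** Point evaluations along a family that meets each compact set finitely often can be
   bounded independently of each other: on each step only finitely many conditions
   remain. *)
Lemma lim_nbhs0_points (I : choiceType) (D : set I) (x : I -> M)
    (U : I -> set E) :
  (forall i, D i -> nbhs 0 (U i)) ->
  (forall i, D i -> convex_set (U i : set (convex_lmodType E))) ->
  (forall K, compact K -> finite_set [set i | D i /\ K (x i)]) ->
  lim_nbhs0 [set f : Crc r M E | forall i, D i -> U i (Crc_val f (x i))].
Proof.
move=> Un Uc Dfin; split.
  apply/convex_setP => t f g t01 fU gU i Di /=.
  by have /convex_setP := Uc i Di; apply => //; [exact: fU|exact: gU].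
move=> K cK; have /finite_seqP[s sE] := Dfin K cK.
have : nbhs (0 : CrK r E K) [set f : CrK r E K | forall i, i \in s -> U i (CrK_val f (x i))].
  have : {subset s <= D} by move=> i si; have : [set` s] i by []; rewrite -sE inE => -[].
  elim: s {sE} => [|i s IH] sD.
    by apply: (@filterS _ (nbhs (0 : CrK r E K)) _ setT) => //; exact: filterT.
  have Di : D i by apply/set_mem/sD; exact: mem_head.
  have n1 : nbhs (0 : CrK r E K) [set f : CrK r E K | U i (CrK_val f (x i))].
    by apply: CrK_eval_nbhs0 => //; exact: Un.
  have n2 := IH (fun j js => sD j (@mem_behead _ (i :: s) _ js)).
  apply: (@filterS _ (nbhs (0 : CrK r E K))) (filterI n1 n2) => f [fi fs] j.
  by rewrite inE => /predU1P[->|/fs].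
apply: (@filterS _ (nbhs (0 : CrK r E K))) => f fs i Di /=.
have [si|si] := boolP (i \in s); first exact: fs.
have nK : ~ K (x i).
  by move=> Kx; move/negP: si; apply; have : [set` s] i by rewrite -sE.
have /asboolP fK := CrK_valP f.
rewrite (_ : Cr_fun _ _ = 0); first by apply: nbhs_singleton; exact: Un.
apply/eqP; apply: contrapT => /negP fx; apply/nK/fK; exact: subset_closure.
Qed.

End DirectLimit.

(** * The multiplication map on one step *)

Section PsiStep.
Context {R : realType} {r : option nat} {M : domain R} {E : tvsType R}.
Context (hE : hausdorff_space E).
Implicit Types (K : set M) (v : E).
Let hR : hausdorff_space R^o. Proof. exact: norm_hausdorff. Qed.

Lemma Psi_linearl v : linear (fun f : Crc r M R^o => Psi f v).
Proof.
move=> a f g; apply: Crc_ext => x /=.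
rewrite !fctE /= scalerDl scalerA; congr (_ *: _ + _).
Qed.

Lemma Psi_linearr (f : Crc r M R^o) : linear (fun v : E => Psi f v).
Proof.
move=> a u v; apply: Crc_ext => x /=.
by rewrite !fctE /= scalerDr !scalerA mulrC.
Qed.

Lemma PsiK_subproof K (f : CrK r R^o K) v :
  MkCr (mul_Cr (CrK_val f) v) \in @CrK_pred R r M E K.
Proof.
have /asboolP fK := CrK_valP f; apply/asboolP; apply: subset_trans fK.
by apply: closureS => x /=; apply: contra_neq => ->; rewrite scale0r.
Qed.

Definition PsiK K (f : CrK r R^o K) v : CrK r E K := MkCrK (PsiK_subproof f v).

Lemma iter_d_PsiK K (f : CrK r R^o K) v k :
  @iter_d R E M (CrK_val (PsiK f v)) k =
  fun y => @iter_d R R^o M (CrK_val f) k y *: v.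
Proof. exact: iter_d_mul. Qed.

Lemma CrK_incl_PsiK K (cK : compact K) (f : CrK r R^o K) v :
  CrK_incl cK (PsiK f v) = Psi (CrK_incl cK f) v.
Proof. exact: Crc_ext. Qed.

(** As d^k (f v) = (d^k f) v, a seminorm p is smaller than 1 on all values of d^k (f v)
   on a set L once |d^k f| < 1 on L and p v < 1. *)
Lemma PsiK_small K (A : set (CrK r E K)) : nbhs (0 : CrK r E K) A ->
  exists Q (U : set E), [/\ nbhs (0 : CrK r R^o K) Q, nbhs (0 : E) U &
    forall f v, Q f -> U v -> A (PsiK f v)].
Proof.
move=> A0.
pose F := filter_from
  [set QU : set (CrK r R^o K) * set E | nbhs (0 : CrK r R^o K) QU.1 /\ nbhs (0 : E) QU.2]
  (fun QU => [set h | exists f v, [/\ QU.1 f, QU.2 v & h = PsiK f v]]).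
have FF : Filter F.
  apply: filter_from_filter; first by exists (setT, setT); split; exact: filterT.
  move=> [Q U] [Q' U'] [/= Q0 U0] [/= Q'0 U'0]; exists (Q `&` Q', U `&` U').
    by split => /=; [apply: (@filterI _ (nbhs (0 : CrK r R^o K)))|exact: filterI].
  by move=> _ [f [v [[Qf Q'f] [Uv U'v] ->]]]; split; exists f, v.
suff /(_ _ A0)[[Q U] /= [Q0 U0] QUA] : F --> (0 : CrK r E K).
  by exists Q, U; split => // f v Qf Uv; apply: QUA; exists f, v.
apply: (@CrK_cvg0 _ _ _ _ hE _ _ FF) => k L U kr cL U0.
have [p cp pU] := gauge U0.
exists ([set f : CrK r R^o K | forall x, L x ->
    ball (0 : R^o) 1 (@iter_d R R^o M (CrK_val f) k x)], [set v | p v < 1]).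
  split => /=; last exact: cont_seminorm_ball.
  apply: CrK_nbhs0 => //; exact: nbhsx_ballx.
move=> _ [f [v [/= fL pv ->]]] x Lx; rewrite iter_d_PsiK; apply: pU => /=.
rewrite cp.1.2; have := fL x Lx; rewrite -ball_normE /= sub0r normrN => /ltW h.
by apply: le_lt_trans pv; rewrite ler_piMl// seminorm_ge0//; case: cp.
Qed.

Lemma Psi_small (W : set (Crc r M E)) K (cK : compact K) : lim_nbhs0 W ->
  exists Q (U : set E), [/\ nbhs (0 : CrK r R^o K) Q, nbhs (0 : E) U &
    forall f v, Q f -> U v -> W (Psi (CrK_incl cK f) v)].
Proof.
move=> [_ /(_ K cK) /PsiK_small[Q [U [Q0 U0 QU]]]].
by exists Q, U; split => // f v Qf Uv; rewrite -CrK_incl_PsiK; exact: QU.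
Qed.

Lemma Crc_in_step (f : Crc r M E) K : compact K ->
  Defs.support (Crc_val f) `<=` K ->
  exists g : CrK r E K, forall cK, CrK_incl cK g = f.
Proof.
move=> cK fK; have gK : Crc_val f \in @CrK_pred R r M E K by apply/asboolP.
by exists (MkCrK gK) => cK'; exact: Crc_ext.
Qed.

(** With this, such a set is a 0-neighbourhood of the direct limit once its trace on
   each step is one. *)
Lemma convex_Psi (B : set E) (W : set (Crc r M E)) :
  convex_set (W : set (convex_lmodType (Crc r M E))) ->
  convex_set ([set f : Crc r M R^o | forall v, B v -> W (Psi f v)]
    : set (convex_lmodType (Crc r M R^o))).
Proof.
move=> /convex_setP Wc; apply/convex_setP => t f g t01 fW gW v Bv.
have -> : Psi (t *: f + (1 - t) *: g) v = t *: Psi f v + (1 - t) *: Psi g v.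
  rewrite Psi_linearl; congr (_ + _).
  have := Psi_linearl v (1 - t) g 0; rewrite addr0 => ->.
  by rewrite -[RHS]addr0; congr (_ + _); apply: Crc_ext => x; exact: scale0r.
by apply: Wc => //; [exact: fW|exact: gW].
Qed.

(** If Q and U are taken to W on a step and B lies in t U, then f in Q / t works. *)
Lemma lim_nbhs0_Psi (B : set E) (W : set (Crc r M E)) :
  von_neumann_bounded B -> lim_nbhs0 W ->
  lim_nbhs0 [set f : Crc r M R^o | forall v, B v -> W (Psi f v)].
Proof.
move=> Bb W0; split; first exact: convex_Psi W0.1.
move=> K cK; have [Q [U [Q0 U0 QU]]] := Psi_small cK W0.
have [t t0 BU] := Bb U U0.
have tn0 : t != 0 by rewrite gt_eqF.
apply: (@filterS _ (nbhs (0 : CrK r R^o K)) _ _ _ _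
  (CrK_scale_nbhs0 hR tn0 Q0)) => f /= Qf v Bv.
have [u Uu <-] := BU t (ler_norm _) v Bv.
have -> : Psi (CrK_incl cK f) (t *: u) = Psi (CrK_incl cK (t *: f)) u.
  by apply: Crc_ext => x /=; rewrite scalerA mulrC.
exact: QU.
Qed.

End PsiStep.

(** * Bounded sets *)

Lemma von_neumann_bounded1 (R : realType) (E : tvsType R) (v : E) :
  von_neumann_bounded [set v].
Proof.
move=> U /(tvs_absorbing v)/nbhs_ballP[e /= e0 eU].
exists (2 / e); first exact: divr_gt0.
move=> s se _ ->; have s0 : 0 < `|s| by apply: lt_le_trans se; exact: divr_gt0.
exists (s^-1 *: v); last by rewrite scalerA divff ?scale1r// -normr_gt0.
apply: eU; rewrite -ball_normE /= sub0r normrN normfV invf_plt ?posrE//.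
apply: lt_le_trans se; rewrite -[ltLHS]mul1r ltr_pM2r ?invr_gt0//.
by rewrite ltr1n.
Qed.

Section AdmissibleSpace.
Context {R : realType} {r : option nat} {M : domain R} (hM : admissible r M).
Context {E : tvsType R} (hE : hausdorff_space E).
Implicit Types (K : set M) (v : E) (f : Crc r M R^o).
Let hR : hausdorff_space R^o. Proof. exact: norm_hausdorff. Qed.

Lemma iter_d_bounded (f : Cr r M R^o) k L : le_order k r -> compact L ->
  exists2 C, 0 < C & forall x, L x -> `|@iter_d R R^o M f k x| <= C.
Proof.
move=> kr cL.
have cg := @admissible_iter_d_continuous R r M hM f k kr.
have /(@compact_bounded _ R^o)[C [_ CP]] :=
  continuous_compact (continuous_subspaceT cg) cL.
exists (`|C| + 1) => [|x Lx]; first by rewrite ltr_pwDr.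
apply: CP; last by exists x.
by rewrite (le_lt_trans (ler_norm _))// ltrDl.
Qed.

(** The differentials of f are bounded on compact sets, by continuity. *)
Lemma Psi_fixed_nbhs0 (W : set (Crc r M E)) f : lim_nbhs0 W ->
  nbhs (0 : E) [set v | W (Psi f v)].
Proof.
move=> W0; have /asboolP[K cK fK] := Crc_valP f.
have [g gf] := Crc_in_step cK fK.
have FF : Filter ((fun v : E => PsiK g v) @ (0 : E)).
  have F1 : Filter (nbhs (0 : E)) by exact: nbhs_filter.
  exact: fmap_filter.
have : (fun v : E => PsiK g v) @ (0 : E) --> (0 : CrK r E K).
  apply: (@CrK_cvg0 _ _ _ _ hE _ _ FF) => k L U kr cL U0.
  have [C C0 LC] := iter_d_bounded (CrK_val g) kr cL.
  have [p cp pU] := gauge U0.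
  have Ci0 : 0 < C^-1 by rewrite invr_gt0.
  apply: (@filterS _ (nbhs (0 : E))) (cont_seminorm_ball cp Ci0) => v /= pv x Lx.
  rewrite (iter_d_PsiK hE); apply: pU => /=; rewrite cp.1.2.
  have p0 : 0 <= p v by apply: seminorm_ge0; case: cp.
  apply: le_lt_trans (ler_wpM2r p0 (LC x Lx)) _.
  by rewrite -ltr_pdivlMl// mulr1.
move=> /(_ _ (W0.2 K cK)).
by apply: (@filterS _ (nbhs (0 : E))) => v /=; rewrite CrK_incl_PsiK gf.
Qed.

(** The direct limit induces on each step its own topology. The seminorms that define
   the topology of a step make sense on the whole limit, where they define convex
   0-neighbourhoods. *)
Lemma Crc_step_trace K (cK : compact K) (Q : set (CrK r R^o K)) :
  nbhs (0 : CrK r R^o K) Q ->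
  exists2 W : set (Crc r M R^o), lim_nbhs0 W &
    forall g, W (CrK_incl cK g) -> Q g.
Proof.
move=> Q0.
pose F := filter_from (@lim_nbhs0 R r M R^o)
  (fun W => [set g : CrK r R^o K | W (CrK_incl cK g)]).
have FF : Filter F.
  apply: filter_from_filter.
    exists setT; split; first by move=> x y l _ _; exact/mem_set.
    by move=> K' cK'; exact: filterT.
  by move=> V W V0 W0; exists (V `&` W); first exact: lim_nbhs0I.
suff /(_ _ Q0)[W W0 WQ] : F --> (0 : CrK r R^o K) by exists W.
apply: (@CrK_cvg0 _ _ _ _ hR _ _ FF) => k L U kr cL /nbhs_ballP[e /= e0 eU].
exists [set f : Crc r M R^o | forall x, L x ->
    `|@iter_d R R^o M (Crc_val f) k x| < e]; last first.
  move=> g gL x Lx; apply: eU; rewrite -ball_normE /= sub0r normrN.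
  exact: gL.
split; last first.
  move=> K' cK'; have := @CrK_nbhs0 _ _ _ _ hR K' k L _ kr cL (nbhsx_ballx (0 : R^o) e e0).
  apply: (@filterS _ (nbhs (0 : CrK r R^o K'))) => g gL x Lx /=.
  by have := gL x Lx; rewrite -ball_normE /= sub0r normrN.
apply/convex_setP => t f g t01 fL gL x Lx /=.
have -> : @iter_d R R^o M (t *: Crc_val f + (1 - t) *: Crc_val g) k =
    fun y => t * @iter_d R R^o M (Crc_val f) k y +
      (1 - t) * @iter_d R R^o M (Crc_val g) k y.
  rewrite (admissible_iter_d_linear hM)//; apply/funext => y; congr (_ + _).
  have := admissible_iter_d_linear hM (1 - t) (Crc_val g) 0 kr.
  rewrite addr0 => ->.
  have -> : @iter_d R R^o M (0 : Cr r M R^o) k = fun=> 0 by exact: iter_d0.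
  by rewrite addr0.
have /andP[t0 t1] := t01; apply: le_lt_trans (ler_normD _ _) _.
rewrite !normrM (ger0_norm t0) [`|1 - t|]ger0_norm ?subr_ge0//.
by apply: ltr_convex => //; [exact: (fL x Lx)|exact: (gL x Lx)].
Qed.

(** Otherwise there are f n in B and points x n, leaving every compact set, with
   f n (x n) != 0. The functions g with |g (x n)| < |f n (x n)| / (n + 1) for all n form
   a 0-neighbourhood which does not absorb B. *)
Lemma bounded_common_support (B : set (Crc r M R^o)) :
  von_neumann_bounded B ->
  exists2 K, compact K & forall f, B f -> Defs.support (Crc_val f) `<=` K.
Proof.
move=> Bb; apply: contrapT => nK.
pose S := [set x : M | exists2 f, B f & Crc_val f x != 0].
have nS K : compact K -> ~ S `<=` K.
  move=> cK SK; apply: nK; exists K => // f Bf; rewrite /Defs.support closureE.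
  move=> y; apply; split; last by move=> x /= fx; apply: SK; exists f.
  by apply: compact_closed => //; exact: admissible_hausdorff hM.
have [V Vc] := admissible_cover hM.
have [x [Sx xfin]] := not_relcompact_sequence Vc nS.
have /choice[f fP] n : exists f, B f /\ Crc_val f (x n) != 0.
  by have [f] := Sx n; exists f.
pose c n := `|Crc_val (f n) (x n)| / n.+1%:R.
have c0 n : 0 < c n by rewrite divr_gt0// normr_gt0; exact: (fP n).2.
have W0 : lim_nbhs0 [set g : Crc r M R^o | forall n, setT n ->
    ball (0 : R^o) (c n) (Crc_val g (x n))].
  apply: (@lim_nbhs0_points _ _ _ _ hR nat setT x
    (fun n => ball (0 : R^o) (c n))) => [n _|n _|K cK].
  - exact: nbhsx_ballx.
  - have sn : seminorm (fun y : R^o => `|y|).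
      by split=> [y z|a y]; [exact: ler_normD|exact: normrM].
    have := @convex_seminorm_ball _ _ _ (c n) sn; congr (convex_set _).
    by apply/seteqP; split => y; rewrite -ball_normE /= sub0r normrN.
  - by apply: sub_finite_set (xfin K cK) => n [].
have [t t0 BW] : exists2 t : R, 0 < t & forall s, t <= `|s| -> B `<=`
   *:%R s @` [set g : Crc r M R^o | forall n, setT n ->
    ball (0 : R^o) (c n) (Crc_val g (x n))].
  apply: Bb; apply/nbhs_Crc => //; eexists; first exact: W0.
  by move=> w; rewrite add0r.
pose n := Num.trunc t.
have tn : t <= `|n.+1%:R : R| by rewrite ger0_norm// ltW// truncnS_gt.
have [w wW wE] := BW _ tn _ (fP n).1.
have := wW n I; rewrite -ball_normE /= sub0r normrN /c -wE.
have -> : Crc_val (n.+1%:R *: w) (x n) = n.+1%:R * Crc_val w (x n) by [].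
by rewrite normrM mulrAC ger0_norm// divff// mul1r ltxx.
Qed.

(** B lies in one step and is absorbed there by each 0-neighbourhood of the step, so the
   estimate on the step applies. *)
Lemma Psi_bounded_small (B : set (Crc r M R^o)) (W : set (Crc r M E)) :
  von_neumann_bounded B -> lim_nbhs0 W ->
  exists2 U : set E, nbhs 0 U & forall f v, B f -> U v -> W (Psi f v).
Proof.
move=> Bb W0; have [K cK BK] := bounded_common_support Bb.
have [Q [U [Q0 U0 QU]]] := Psi_small hE cK W0.
have [P P0 PQ] := Crc_step_trace cK Q0.
have [t t0 BP] : exists2 t : R, 0 < t & forall s, t <= `|s| -> B `<=` *:%R s @` P.
  by apply: Bb; apply/nbhs_Crc => //; exists P => // w; rewrite add0r.
have tn0 : t != 0 by rewrite gt_eqF.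
exists [set v | U (t *: v)]; first exact: nbhs0_scale.
move=> f v Bf Uv; have [w Pw wf] := BP t (ler_norm _) f Bf.
have wK : Defs.support (Crc_val w) `<=` K.
  apply: subset_trans (BK f Bf); apply: closureS => x /= wx.
  by rewrite -wf; rewrite (_ : Cr_fun _ _ = t * Crc_val w x)// mulf_neq0.
have [g gw] := Crc_in_step cK wK.
have -> : Psi f v = Psi w (t *: v).
  by rewrite -wf; apply: Crc_ext => x /=; rewrite scalerA mulrC.
by rewrite -(gw cK); apply: QU => //; apply: PQ; rewrite gw.
Qed.

Lemma Psi_cvg_within (S : set (Crc r M R^o * E)) f0 v0 :
  (forall W : set (Crc r M E), lim_nbhs0 W ->
     exists P (U : set E), [/\ lim_nbhs0 P, nbhs 0 U & forall f v,
       S (f, v) -> P (f - f0) -> U (v - v0) -> W (Psi f v - Psi f0 v0)]) ->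
  (fun p : Crc r M R^o * E => Psi p.1 p.2) @ within S (nbhs (f0, v0)) --> Psi f0 v0.
Proof.
move=> H A /(nbhs_Crc hE)[W W0 WA].
have [P [U [P0 U0 PU]]] := H W W0.
exists ([set f | P (f - f0)], [set v | U (v - v0)]).
  split => /=.
    by apply/nbhs_Crc => //; exists P => // w Pw /=; rewrite addrC addKr.
  apply/nbhs_translate; apply: filterS U0 => v Uv /=.
  by rewrite addrC addKr.
move=> [f v] [/= Pf Uv] Sfv; rewrite -[Psi f v](subrK (Psi f0 v0)) addrC.
by apply: WA; exact: PU.
Qed.

End AdmissibleSpace.

(** * Hypocontinuity and continuity *)

Section Continuity.
Context {R : realType} {r : option nat} {M : domain R} (hM : admissible r M).
Context {E : tvsType R} (hE : hausdorff_space E).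
Let hR : hausdorff_space R^o. Proof. exact: norm_hausdorff. Qed.
Let Psi2 (p : Crc r M R^o * E) := Psi p.1 p.2.

Lemma PsiDl (f g : Crc r M R^o) (v : E) : Psi (f + g) v = Psi f v + Psi g v.
Proof. by have := Psi_linearl v 1 f g; rewrite !scale1r. Qed.

Lemma PsiDr (f : Crc r M R^o) (u v : E) : Psi f (u + v) = Psi f u + Psi f v.
Proof. by have := Psi_linearr f 1 u v; rewrite !scale1r. Qed.

Lemma PsiBr (f f0 : Crc r M R^o) (v v0 : E) :
  Psi f v - Psi f0 v0 = Psi f (v - v0) + Psi (f - f0) v0.
Proof.
have -> : Psi f v = Psi f (v - v0) + Psi f v0 by rewrite -PsiDr subrK.
have -> : Psi f v0 = Psi (f - f0) v0 + Psi f0 v0 by rewrite -PsiDl subrK.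
by rewrite addrA addrK.
Qed.

Lemma PsiBl (f f0 : Crc r M R^o) (v v0 : E) :
  Psi f v - Psi f0 v0 = Psi (f - f0) v + Psi f0 (v - v0).
Proof.
have -> : Psi f v = Psi (f - f0) v + Psi f0 v by rewrite -PsiDl subrK.
have -> : Psi f0 v = Psi f0 (v - v0) + Psi f0 v0 by rewrite -PsiDr subrK.
by rewrite addrA addrK.
Qed.

Lemma Psi00 : Psi (0 : Crc r M R^o) (0 : E) = 0.
Proof. by apply: Crc_ext => x; exact: scale0r. Qed.

Lemma Psi_hypocontinuous :
  hypocontinuous (fun (f : Crc r M R^o) (v : E) => Psi f v).
Proof.
split; [split| |].
- move=> f v A /(nbhs_Crc hE)[W W0 WA].
  apply/nbhs_translate; apply: filterS (Psi_fixed_nbhs0 hM hE f W0) => u /= Wu.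
  by rewrite PsiDr; exact: WA.
- move=> v f A /(nbhs_Crc hE)[W W0 WA]; apply/(nbhs_Crc hR).
  exists [set g | forall w, [set v] w -> W (Psi g w)].
    by apply: lim_nbhs0_Psi => //; exact: von_neumann_bounded1.
  by move=> g Wg /=; rewrite PsiDl; apply: WA; exact: Wg.
- move=> B Bb; apply/subspace_continuousP => -[f0 v0] [/= Bf0 _].
  apply: (@Psi_cvg_within _ _ _ _ hE) => W W0.
  have [V V0 VW] := lim_nbhs0_split hE W0.
  have [U U0 BU] := Psi_bounded_small hM hE Bb V0.
  exists [set g | forall w, [set v0] w -> V (Psi g w)], U; split => //.
    by apply: lim_nbhs0_Psi => //; exact: von_neumann_bounded1.
  move=> f v [/= Bf _] Pf Uv; rewrite PsiBr; apply: VW; first exact: BU.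
  exact: Pf.
- move=> B Bb; apply/subspace_continuousP => -[f0 v0] [/= _ Bv0].
  apply: (@Psi_cvg_within _ _ _ _ hE) => W W0.
  have [V V0 VW] := lim_nbhs0_split hE W0.
  exists [set g | forall w, B w -> V (Psi g w)], [set u | V (Psi f0 u)]; split.
  + exact: lim_nbhs0_Psi.
  + exact: Psi_fixed_nbhs0.
  + by move=> f v [/= _ Bv] Pf Uv; rewrite PsiBl; apply: VW => //; exact: Pf.
Qed.

Lemma Psi_continuousP :
  continuous Psi2 <->
  forall W : set (Crc r M E), lim_nbhs0 W -> exists P (U : set E),
    [/\ lim_nbhs0 P, nbhs 0 U & forall f v, P f -> U v -> W (Psi f v)].
Proof.
split=> [Pc W W0|H [f0 v0]].
  have n0 : nbhs (Psi2 (0, 0)) W.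
    by apply/(nbhs_Crc hE); exists W => // w; rewrite /Psi2 /= Psi00 add0r.
  have [[A U] /= [A0 U0] AU] := Pc (0, 0) W n0.
  have [P P0 PA] := (nbhs_Crc hR 0 A).1 A0.
  exists P, U; split => // f v Pf Uv; apply: (AU (f, v)); split => //=.
  by rewrite -[f]add0r; exact: PA.
have : Psi2 @ within setT (nbhs (f0, v0)) --> Psi f0 v0.
  apply: (@Psi_cvg_within _ _ _ _ hE) => W W0.
  have [V V0 VW] := lim_nbhs0_split hE W0.
  have [V' V'0 V'V] := lim_nbhs0_split hE V0.
  have [P [U [P0 U0 PU]]] := H V' V'0.
  exists (P `&` [set g | forall w, [set v0] w -> V (Psi g w)]),
    (U `&` [set u | V' (Psi f0 u)]); split.
  - apply: lim_nbhs0I => //; apply: lim_nbhs0_Psi => //.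
    exact: von_neumann_bounded1.
  - by apply: filterI => //; exact: Psi_fixed_nbhs0.
  - move=> f v _ [Pf Pf0] [Uv Uv0]; rewrite PsiBr; apply: VW; last exact: Pf0.
    by rewrite -[in X in V X](subrK f0 f) PsiDl; apply: V'V => //; exact: PU.
by rewrite withinET.
Qed.

(** Fatten the members of a least compact cover; every compact set lies in
   one of their finite unions Ks s. For each s let p s be a seminorm whose unit ball
   works on the step Ks s, and let q dominate all of them. The set of f with f v in W
   whenever q v < 1 is convex, and its trace on a step K inside Ks s contains a
   multiple of the neighbourhood found for Ks s. *)
Lemma neighbourhood_Psi_continuous :
  neighbourhood_property E (compact_covering_number M) -> continuous Psi2.
Proof.
move=> hE'; apply/Psi_continuousP => W W0.
pose C := compact_covering_number M.
have [[Ccpt Ccov] _] : min_compact_cover C by exact: compact_covering_numberP.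
have iC : infinite_set C by apply: covering_number_infinite; exact: admissible_noncompact hM.
have /choice[fat fatP] (K : set M) :
    exists K', compact K' /\ (compact K -> K `<=` interior K').
  have [cK|ncK] := pselect (compact K); last by exists set0; split => //; exact: compact0.
  have [K' cK' KK'] := compact_fattening (admissible_compact_nbhs hM) cK.
  by exists K'.
pose Ks (s : seq (set M)) := \bigcup_(K in [set` s]) fat K.
have cKs s : compact (Ks s).
  apply: finite_bigcup_compact => [|K _]; last exact: (fatP K).1.
  exact: finite_seq.
have /choice[p pP] (s : seq (set M)) : exists p : E -> R, cont_seminorm p /\
    exists2 Q, nbhs (0 : CrK r R^o (Ks s)) Q &
      forall f v, Q f -> p v < 1 -> W (Psi (CrK_incl (cKs s) f) v).
  have [Q [U [Q0 U0 QU]]] := Psi_small hE (cKs s) W0.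
  have [p cp pU] := gauge U0.
  by exists p; split => //; exists Q => // f v Qf pv; apply: QU => //; exact: pU.
have [q cq qP] := neighbourhood_seq hE' iC (fun s => (pP s).1).
exists [set f | forall v, [set v | q v < 1] v -> W (Psi f v)], [set v | q v < 1].
split; [|exact: cont_seminorm_ball cq ltr01|by move=> f v; apply].
split; first exact: convex_Psi W0.1.
move=> K cK.
have [s sC KKs] : exists2 s : seq (set M), (forall K', K' \in s -> C K') & K `<=` Ks s.
  apply: compact_finite_subcover cK _ => x _.
  have : setT x by [].
  rewrite -Ccov => -[K' CK' K'x].
  by exists K' => //; apply: (fatP K').2 => //; exact: Ccpt.
have [c c0 pq] := qP s sC; have cn0 : c != 0 by rewrite gt_eqF.
have [_ [Q Q0 QW]] := pP s.
have := CrK_widen_scale_cvg0 hR KKs cn0 Q0.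
apply: (@filterS _ (nbhs (0 : CrK r R^o K))) => f /= Qf v qv.
have -> : Psi (CrK_incl cK f) v =
    Psi (CrK_incl (cKs s) (c *: CrK_widen KKs f)) (c^-1 *: v).
  apply: Crc_ext => x /=.
  by rewrite scalerA mulrAC [X in X *: _](_ : _ = Crc_val (CrK_incl cK f) x)// mulfV// mul1r.
apply: QW => //; rewrite (pP s).1.1.2 gtr0_norm ?invr_gt0//.
by rewrite ltr_pdivrMl// mulr1; apply: le_lt_trans (pq v) _; rewrite gtr_pMr.
Qed.

(** Distinct seminorms p in P get points x p in distinct members of a locally finite
   cover, which has enough members. The conditions p (g (x p)) < 1 define a
   0-neighbourhood W. If f v is in W for f in Q and q v < 1, then a multiple e f in Q of
   a bump function f with f (x p) = 1 shows p <= q / e. *)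
Lemma Psi_continuous_neighbourhood :
  continuous Psi2 -> neighbourhood_property E (compact_covering_number M).
Proof.
move=> /Psi_continuousP Pc P Pcs Pcard.
have [[p0 Pp0]|nP] := pselect (P !=set0); last first.
  exists (fun=> 0); last by move=> p Pp; exfalso; apply: nP; exists p.
  split; last exact: cst_continuous.
  by split => [x y|a x]; rewrite ?addr0 ?mulr0.
have [V Vc] := admissible_cover hM.
have [_ Vn0 _ Vlf] := Vc.
have /pcard_leP[i] := card_le_trans Pcard (covering_number_le Vc).
have [x0 _] : i p0 !=set0 by apply: Vn0; exact: funS.
have /choice[x xP] (p : E -> R) : exists x, P p -> i p x.
  have [Pp|nPp] := pselect (P p); last by exists x0.
  have [y iy] : i p !=set0 by apply: Vn0; exact: funS.
  by exists y.
pose W := [set g : Crc r M E | forall p, P p -> [set v | p v < 1] (Crc_val g (x p))].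
have W0 : lim_nbhs0 W.
  apply: (@lim_nbhs0_points _ _ _ _ hE _ P x (fun p => [set v | p v < 1])).
  - by move=> p /Pcs cp; exact: cont_seminorm_ball.
  - by move=> p /Pcs [sp _]; exact: convex_seminorm_ball.
  - move=> K cK; have fV := locally_finite_compact Vlf cK.
    set S := (X in finite_set X).
    have : finite_set (i @` S).
      apply: sub_finite_set fV => _ [p [Pp Kp] <-]; split; first exact: funS.
      by exists (x p); split => //; exact: xP.
    have iS : {in S &, injective i}.
      move=> p p' /set_mem[Pp _] /set_mem[Pp' _].
      by apply: 'inj_i; rewrite inE.
    by rewrite (eq_finite_set (inj_card_eq iS)).
have [Q [U [Q0 U0 QU]]] := Pc W W0.
have [q cq qU] := gauge U0.
exists q => // p Pp.
have [f f1] := admissible_bump hM (x p).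
have [e e0 Qe] : exists2 e : R, 0 < e & Q (e *: f).
  have /nbhs_ballP[e /= e0 eQ] := Psi_fixed_nbhs0 hM hR f Q0.
  exists (e / 2); first exact: divr_gt0.
  have -> : (e / 2) *: f = Psi f (e / 2 : R^o).
    apply: Crc_ext => y; rewrite Crc_valZ.
    by transitivity (Crc_val f y *: (e / 2 : R^o)) => //; exact: mulrC.
  apply: eQ; rewrite -ball_normE /= sub0r normrN gtr0_norm ?divr_gt0//.
  by rewrite ltr_pdivrMr// ltr_pMr// ltr1n.
have cp := Pcs p Pp.
apply: (@preceq_ball _ _ _ _ e^-1); [by case: cp|by case: cq|by rewrite invr_gt0|].
move=> v qv; have := QU (e *: f) v Qe (qU v qv) p Pp.
have -> : Crc_val (Psi (e *: f) v) (x p) = e *: v.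
  transitivity (Crc_val (e *: f) (x p) *: v) => //.
  by rewrite Crc_valZ f1 [e *: _]mulr1.
by rewrite /= cp.1.2 gtr0_norm// -ltr_pdivlMl// mulr1.
Qed.

End Continuity.

Theorem theoremB (R : realType) (E : tvsType R) (hE : hausdorff_space E)
    (r : option nat) (M : domain R) (hM : admissible r M) :
  [/\ (forall v : E, linear (fun f : Crc r M R^o => Psi f v)) /\
        (forall f : Crc r M R^o, linear (fun v : E => Psi f v)),
      hypocontinuous (fun (f : Crc r M R^o) (v : E) => Psi f v),
      continuous (fun p : Crc r M R^o * E => Psi p.1 p.2) <->
        neighbourhood_property E (compact_covering_number M)
    & metrizable R E ->
        (continuous (fun p : Crc r M R^o * E => Psi p.1 p.2) <-> normable E)].
Proof.
have iff : continuous (fun p : Crc r M R^o * E => Psi p.1 p.2) <->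
    neighbourhood_property E (compact_covering_number M).
  by split; [exact: Psi_continuous_neighbourhood|exact: neighbourhood_Psi_continuous].
split => //; first by split; [exact: Psi_linearl|exact: Psi_linearr].
  exact: Psi_hypocontinuous.
move=> mE; split=> [/iff|nE].
  apply: neighbourhood_normable => //; apply: covering_number_infinite.
  exact: admissible_noncompact hM.
apply/iff; exact: normable_neighbourhood.
Qed.
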